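(* Let $p\in\mathbb N$, let $\mathcal A=\{a_0,\dots,a_p\}\subset\mathbb C$ be a set of $p+1$ distinct points, $A(z)=\prod_{i=0}^p(z-a_i)$, and let $B(z)=\alpha z^p+\text{lower degree terms}$, $\alpha\in\mathbb C$, be a polynomial of degree at most $p$ (both independent of $n$). Let $(Q_n)$ be a sequence of Heine-Stieltjes polynomials associated with $A,B$, $\deg Q_n=n$. Then any weak-* limit point of the normalized zero counting measures $\nu(Q_n)/n$ is a unit continuous $\mathcal A$-critical measure.
   Context: A Heine-Stieltjes polynomial of degree $n$ is a polynomial $Q_n$ of degree $n$ which solves $A(z)y''(z)+B(z)y'(z)-n(n+\alpha-1)V_n(z)y(z)=0$ for some polynomial $V_n$ of degree $\le p-1$ (the corresponding Van Vleck polynomial; if $\deg V_n=p-1$, then $V_n$ is monic). For a polynomial $P$ with zeros $\zeta_1,\dots,\zeta_n$ counted with multiplicity, $\nu(P)=\sum_{j=1}^n\delta_{\zeta_j}$. For a finite real (signed) Borel measure $\mu$ with compact support in $\mathbb C$, $E(\mu)=\iint\log\frac1{|x-y|}\,d\mu(x)d\mu(y)$. A smooth complex-valued function $h$ generates the local variation $z\mapsto z^t=z+t\,h(z)$, $t\in\mathbb C$ small, and $\mu^t$ is defined by $d\mu^t(x^t)=d\mu(x)$. $\mu$ is a continuous $\mathcal A$-critical measure (external field $\varphi\equiv0$) if for every smooth $h$ with $h|_{\mathcal A}\equiv0$, $\frac{d}{dt}E(\mu^t)|_{t=0}=\lim_{t\to0}\frac{E(\mu^t)-E(\mu)}{t}=0$.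 ''Unit'' means total mass $1$. *)

(* Defs.v *)
From HB Require Import structures.
From mathcomp Require Import all_boot all_order all_algebra.
From mathcomp Require Import all_classical all_reals all_analysis.
From mathcomp Require Import complex.

Set Implicit Arguments.
Unset Strict Implicit.
Unset Printing Implicit Defensive.

Import Order.TTheory GRing.Theory Num.Theory.
Import numFieldNormedType.Exports.

Local Open Scope classical_set_scope.
Local Open Scope complex_scope.
Local Open Scope ring_scope.

(* R[i] with its usual topology and the Borel sigma-algebra. *)
HB.instance Definition _ (R : realType) := NormedModule.copy R[i] R[i]^o.

HB.instance Definition _ (R : realType) :=
  @isMeasurable.Build (sigma_display (@open R[i])) R[i] <<s @open R[i] >>
    (@sigma_algebra0 _ setT (@open R[i])) (@sigma_algebraC R[i] (@open R[i]))
    (@sigma_algebra_bigcup _ setT (@open R[i])).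

Section Charges.
Context d (T : measurableType d) (R : realType).
Implicit Type mu : {charge set T -> \bar R}.

Definition hahn_pos mu : set T := sval (cid (Hahn_decomposition mu)).

Definition hahn_neg mu : set T := sval (cid (svalP (cid (Hahn_decomposition mu)))).

Lemma hahn_posnegP mu : hahn_decomposition mu (hahn_pos mu) (hahn_neg mu).
Proof. exact: (svalP (cid (svalP (cid (Hahn_decomposition mu))))). Qed.

Definition total_variation mu : {measure set T -> \bar R} :=
  charge_variation (hahn_posnegP mu).

Definition charge_integral mu (f : T -> \bar R) : \bar R :=
  (\int[jordan_pos (hahn_posnegP mu)]_x f x
   - \int[jordan_neg (hahn_posnegP mu)]_x f x)%E.

End Charges.

Definition image_charge d1 d2 (T1 : measurableType d1) (T2 : measurableType d2)
    (R : realType) (mu : {charge set T1 -> \bar R}) (f : T1 -> T2)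
    (mf : measurable_fun [set: T1] f) : {charge set T2 -> \bar R} :=
  measure_function_pushforward__canonical__charge_Charge mu mf.

Section CriticalMeasures.
Context (R : realType).
Local Notation C := R[i].
Implicit Type mu : {charge set C -> \bar R}.

Definition charge_support mu : set C :=
  [set z | forall U : set C, open U -> U z -> (0 < total_variation mu U)%E].

(* log (1 / |x - y|); it is +oo on the diagonal since lne 0 = -oo, whereas the
   real-valued ln would give 0 there. *)
Definition log_kernel (x y : C) : \bar R :=
  (- lne (ComplexField.Normc.normc (x - y))%:E)%E.

Definition finite_energy mu : Prop :=
  (\int[total_variation mu]_x \int[total_variation mu]_y `|log_kernel x y|
   < +oo)%E.

Definition energy mu : \bar R :=
  charge_integral mu (fun x => charge_integral mu (log_kernel x)).

(* k times continuously differentiable functions of two real variables *)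
Fixpoint Ck (k : nat) (u : R * R -> R) : Prop :=
  if k is j.+1 then
    [/\ forall q, derivable u q (1, 0), forall q, derivable u q (0, 1),
        Ck j (fun q => 'D_(1, 0) u q) & Ck j (fun q => 'D_(0, 1) u q)]
  else continuous u.

(* C^oo in the real sense; continuity, which follows from the second conjunct,
   is kept apart to give the measurability used in local_variation. *)
Definition smooth (h : C -> C) : Prop :=
  continuous h /\
  forall k, Ck k (fun q => complex.Re (h (q.1 +i* q.2))) /\
            Ck k (fun q => complex.Im (h (q.1 +i* q.2))).

Lemma measurable_variation (h : C -> C) (t : C) : smooth h ->
  measurable_fun [set: C] (fun z : C => z + t * h z).
Proof.
move=> [ch _]; pose g (z : C) : C := z + t * h z.
have cg : continuous g.
  move=> z; apply: (@cvgD R[i] C _ (nbhs z) _ idfun); first exact: cvg_id.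
  by apply: (@cvgZl_tmp R[i] C); exact: ch.
apply: (@measurability _ _ C C setT g (@open C)) => //.
move=> _ [U oU <-]; rewrite setTI; apply: sub_sigma_algebra.
by apply: open_comp oU => z _; exact: cg.
Qed.

(* The charge mu^t. *)
Definition local_variation mu (h : C -> C) (sh : smooth h) (t : C) :
    {charge set C -> \bar R} :=
  image_charge mu (measurable_variation t sh).

(* Finite energy is required for E(mu) to make sense. It passes to mu^t for
   small t because z |-> z + t h(z) is bi-Lipschitz on the compact support, so
   that fine only acts on finite energies near t = 0. *)
Definition continuous_critical (A : set C) mu : Prop :=
  [/\ compact (charge_support mu), finite_energy mu &
      forall (h : C -> C) (sh : smooth h), (forall a, A a -> h a = 0) ->
        (fun t : C => (fine (energy (local_variation mu sh t))
                       - fine (energy mu))%:C / t) @ 0^' --> (0 : C)].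

Definition heine_stieltjes (p n : nat) (alpha : C) (A B Q : {poly C}) : Prop :=
  size Q = n.+1 /\
  exists V : {poly C},
    [/\ (size V <= p)%N, size V = p -> V \is monic &
        A * Q^`(2) + B * Q^`() - (n%:R * (n%:R + alpha - 1)) *: (V * Q) = 0].

Definition zeros (P : {poly C}) : seq C := sval (closed_field_poly_normal P).

Definition zero_counting (P : {poly C}) : {measure set C -> \bar R} :=
  msum (fun j => \d_((zeros P)`_j)) (size (zeros P)).

Definition normalized_zero_counting (n : nat) (P : {poly C}) :
    {measure set C -> \bar R} :=
  mscale (n%:R^-1)%:nng (zero_counting P).

Definition weak_star_cvg (nu : nat -> {measure set C -> \bar R}) mu : Prop :=
  forall f : C -> R, continuous f -> compact (closure [set z | f z != 0]) ->
    (fun k => \int[nu k]_z (f z)%:E)%E @ \oo -->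
      charge_integral mu (fun z => (f z)%:E).

Definition weak_star_limit_point (nu : nat -> {measure set C -> \bar R}) mu :
    Prop :=
  exists s : nat -> nat, {homo s : m n / (m < n)%N} /\
    weak_star_cvg (fun k => nu (s k)) mu.

End CriticalMeasures.

(* Main.v *)
Require Import Defs.
From HB Require Import structures.
From mathcomp Require Import all_boot all_order all_algebra.
From mathcomp Require Import all_classical all_reals all_analysis.
From mathcomp Require Import complex.
From mathcomp Require Import measurable_realfun ring lra.
Import Order.TTheory GRing.Theory Num.Theory.
Import numFieldNormedType.Exports.
Local Open Scope classical_set_scope.
Local Open Scope complex_scope.
Local Open Scope ring_scope.

(** At a zero [x] of [Q n] with [A x != 0] the differential equation reads
[2 \sum_(y != x) (x - y)^-1 = - B x / A x]: the zeros are in electrostatic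
equilibrium. Multiplying by a field [h] which vanishes on the zeros of [A],
summing over [x] and symmetrizing gives
[\sum_x \sum_y (h x - h y) / (x - y) = - \sum_x h x * B x / A x]
([stationary_variation]). The right-hand side has only [n] bounded terms when [h]
is Lipschitz. Everything follows from this identity and from the fact that the
multiplicities of the zeros are bounded independently of [n].

The zeros stay in a fixed disc ([stationary_bounded]): the zero of largest
modulus is repelled outwards by the [n - 1] others, with a total force of order
[n], whereas [B / A] decays at infinity. Hence a weak limit [m] of the
normalized counting measures is a probability measure with compact support
([weak_limit_probability]).

For finite energy, the identity is applied to the gradient of a convex function
with second derivative [1 / r] on a disc of radius [r], corrected by an
interpolating field so as to vanish on the zeros of [A]. Gradients of convex
functions are monotone, so every pair of zeros contributes a nonnegative real
part, and [1 / r] if both zeros are in the disc. The disc then contains at most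
of the order of [n * sqrt (r + 1 / n)] zeros ([stationary_count_disc]), and its
[m]-mass is [O(sqrt r)] ([disc_bound]), which makes the logarithmic kernel
integrable ([log_kernel_integrable]).

The disc bound also shows that pairs of zeros close to each other are negligible
uniformly in [n]. The kernel [(h x - h y) / (x - y)], which is bounded but
discontinuous on the diagonal, can therefore be integrated in the weak limit, and
its integral against [m * m] has a vanishing real part ([first_variation]).
Since [x^t - y^t = (x - y) (1 + t (h x - h y) / (x - y))], the first order term
of the energy of [m^t] is minus the real part of the integral of
[t (h x - h y) / (x - y)], that is, zero by the same statement for the field
[t h]; the remainder is [O(|t|^2)] ([energy_variation_bound]). *)

Set Implicit Arguments.
Unset Strict Implicit.
Unset Printing Implicit Defensive.

Import ComplexField.Normc.

(** * Roots of polynomial solutions of second order equations *)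

Section RootsOfODE.
Variable F : numFieldType.
Implicit Types (s : seq F) (z : F) (P A B G q : {poly F}).

Lemma logarithmic_derivative s z : z \notin s ->
  (\prod_(w <- s) ('X - w%:P))^`().[z] =
  (\prod_(w <- s) ('X - w%:P)).[z] * \sum_(w <- s) (z - w)^-1.
Proof.
elim: s => [|w s IH]; first by rewrite !big_nil derivC hornerC mulr0.
rewrite inE negb_or => /andP[zw zs].
rewrite !big_cons derivM derivXsubC mul1r !hornerE IH //.
have zw0 : z - w != 0 by rewrite subr_eq0.
by rewrite mulrDr mulrAC divff // mul1r mulrA.
Qed.

(** With [D := 'X - z], the operator [D * d/dX] multiplies [D ^+ m] by [m]; in
terms of it no case distinction on small [m] is needed. *)
Let euler z m q : ('X - z%:P) * (('X - z%:P) ^+ m * q)^`() =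
  ('X - z%:P) ^+ m * (m%:R *: q + ('X - z%:P) * q^`()).
Proof.
rewrite derivM deriv_exp derivXsubC mul1r -scaler_nat; case: m => [|m].
  by rewrite !scale0r !mul0r !add0r !expr0 !mul1r.
by rewrite /= exprS -!mul_polyC; ring.
Qed.

Let euler2 z m q :
  ('X - z%:P) ^+ 2 * (('X - z%:P) ^+ m * q)^`(2) =
  ('X - z%:P) ^+ m * ((m%:R * (m%:R - 1)) *: q
     + (2 * m%:R) *: (('X - z%:P) * q^`()) + ('X - z%:P) ^+ 2 * q^`(2)).
Proof.
set D := 'X - z%:P; set P := D ^+ m * q.
have e : D * P^`() = D ^+ m * (m%:R *: q + D * q^`()) by exact: euler.
have := congr1 (fun p => D * p^`()) e.
have /= := euler z m (m%:R *: q + D * q^`()); rewrite -/D => ->.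
rewrite [(D * P^`())^`()]derivM derivXsubC mul1r mulrDr e.
move=> h.
have -> : D ^+ 2 * P^`()^`() = D * (D * P^`()^`()) by rewrite mulrA.
apply: (addrI (D ^+ m * (m%:R *: q + D * q^`()))); rewrite h.
rewrite derivD derivZ derivM derivXsubC -!mul_polyC.
rewrite !polyCM !polyCB; ring.
Qed.

(** After multiplication by [D ^+ 2] each term of the equation for [D ^+ m * q] is
divisible by [D ^+ m], which is cancelled here. *)
Let master A B G z m q :
  A * (('X - z%:P) ^+ m * q)^`(2) + B * (('X - z%:P) ^+ m * q)^`() =
    G * (('X - z%:P) ^+ m * q) ->
  A * ((m%:R * (m%:R - 1)) *: q
     + (2 * m%:R) *: (('X - z%:P) * q^`()) + ('X - z%:P) ^+ 2 * q^`(2))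
  + B * ('X - z%:P) * (m%:R *: q + ('X - z%:P) * q^`()) =
  G * ('X - z%:P) ^+ 2 * q.
Proof.
move=> /(congr1 (fun p => ('X - z%:P) ^+ 2 * p)).
set D := 'X - _; set P := D ^+ m * q => h.
have Dm0 : D ^+ m != 0 by rewrite expf_neq0 // polyXsubC_eq0.
apply: (mulfI Dm0).
have e1 := euler z m q; have e2 := euler2 z m q.
rewrite -/D -/P in e1 e2.
transitivity (A * (D ^+ 2 * P^`(2)) + B * D * (D * P^`())).
  by rewrite e1 e2; ring.
by transitivity (D ^+ 2 * (G * P)); [rewrite -h; ring | rewrite /P; ring].
Qed.

(** The indicial equation at an ordinary point is [m * (m - 1) = 0]. *)
Lemma multiplicity_ordinary A B G z m q : q.[z] != 0 -> A.[z] != 0 ->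
  A * (('X - z%:P) ^+ m * q)^`(2) + B * (('X - z%:P) ^+ m * q)^`() =
    G * (('X - z%:P) ^+ m * q) ->
  (m <= 1)%N.
Proof.
move=> q0 A0 /master /(congr1 (fun p => p.[z])).
rewrite !hornerE subrr !(mulr0, mul0r, addr0) /= expr0n /= !(mulr0, mul0r, addr0).
move/eqP; rewrite !mulf_eq0 (negbTE q0) (negbTE A0) orbF /= pnatr_eq0.
by case: m => [|[|m]] //=; rewrite subr_eq0 (eqr_nat _ m.+2 1).
Qed.

(** The indicial equation at a simple zero of the leading coefficient. The value
at [z] of the cofactor [A] is the derivative of that coefficient. *)
Lemma multiplicity_singular A B G z m q : q.[z] != 0 ->
  ('X - z%:P) * A * (('X - z%:P) ^+ m * q)^`(2)
    + B * (('X - z%:P) ^+ m * q)^`() = G * (('X - z%:P) ^+ m * q) ->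
  (0 < m)%N -> (m%:R - 1) * A.[z] = - B.[z].
Proof.
move=> q0 /master; set D := 'X - _ => h m0.
have D0 : D != 0 by rewrite polyXsubC_eq0.
have : D * (A * ((m%:R * (m%:R - 1)) *: q
     + (2 * m%:R) *: (D * q^`()) + D ^+ 2 * q^`(2))
  + B * (m%:R *: q + D * q^`())) = D * (G * D * q).
  by transitivity (G * D ^+ 2 * q); [rewrite -h; ring | ring].
move/(mulfI D0)/(congr1 (fun p => p.[z])).
rewrite !hornerE subrr !(mulr0, mul0r, addr0) /= expr0n /= !(mulr0, mul0r, addr0).
move=> e; apply/eqP; rewrite -subr_eq0 opprK.
have : m%:R * q.[z] * ((m%:R - 1) * A.[z] + B.[z]) = 0.
  by apply: etrans e; ring.
by move/eqP; rewrite !mulf_eq0 (negbTE q0) pnatr_eq0 eqn0Ngt m0.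
Qed.

(** If [P = ('X - z) * q], then [P' = q] and [P'' = 2 q'] at [z]. *)
Lemma equilibrium_at_root A B G z q : q.[z] != 0 ->
  A * (('X - z%:P) * q)^`(2) + B * (('X - z%:P) * q)^`() =
    G * (('X - z%:P) * q) ->
  2 * A.[z] * q^`().[z] + B.[z] * q.[z] = 0.
Proof.
move=> q0; set D := 'X - _ => h.
have e1 : (D * q)^`() = q + D * q^`() by rewrite derivM derivXsubC mul1r.
have e2 : (D * q)^`(2) = 2 * q^`() + D * q^`(2).
  rewrite derivnS derivn1 e1 derivD derivM derivXsubC derivnS derivn1; ring.
move: h; rewrite e1 e2 => /(congr1 (fun p => p.[z])).
have -> : A * (2 * q^`() + D * q^`(2)) + B * (q + D * q^`()) =
   2%:P * A * q^`() + B * q + D * (A * q^`(2) + B * q^`()).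
  by rewrite polyCMn; ring.
have D0 : D.[z] = 0 by rewrite hornerXsubC subrr.
clearbody D; clear e1 e2.
by rewrite !(mulrCA G) !(hornerD, hornerM) D0 !mul0r addr0 !hornerC.
Qed.

Lemma prod_XsubC_count s z :
  \prod_(w <- s) ('X - w%:P) = ('X - z%:P) ^+ count_mem z s *
    \prod_(w <- [seq w <- s | w != z]) ('X - w%:P).
Proof.
rewrite (bigID (fun w => w == z)) /= big_filter; congr (_ * _).
rewrite -big_filter (eq_big_seq (fun=> 'X - z%:P)); last first.
  by move=> w; rewrite mem_filter => /andP[/eqP ->].
by rewrite big_const_seq count_predT size_filter iter_mulr_1.
Qed.

(** The convention [0^-1 = 0] suppresses self-interactions. *)
Lemma sum_inv_filter s z : \sum_(w <- s) (z - w)^-1 =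
  \sum_(w <- [seq w <- s | w != z]) (z - w)^-1.
Proof.
rewrite (bigID (fun w => w == z)) /= big_filter.
by rewrite big1 ?add0r // => w /eqP ->; rewrite subrr invr0.
Qed.

Section roots.
Variables (A B G : {poly F}) (c : F) (s : seq F).
Hypothesis (c0 : c != 0).
Let P := c *: \prod_(w <- s) ('X - w%:P).
Hypothesis ode : A * P^`(2) + B * P^`() = G * P.

Let cofactor z := c *: \prod_(w <- [seq w <- s | w != z]) ('X - w%:P).

Let PE z : P = ('X - z%:P) ^+ count_mem z s * cofactor z.
Proof. by rewrite /P (prod_XsubC_count s z) scalerAr. Qed.

Let notin z : z \notin [seq w <- s | w != z].
Proof. by rewrite mem_filter eqxx. Qed.

Let cofactor_neq0 z : (cofactor z).[z] != 0.
Proof.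
rewrite hornerZ mulf_neq0 // -/(root _ _) root_prod_XsubC.
exact: notin.
Qed.

Lemma root_simple z : A.[z] != 0 -> (count_mem z s <= 1)%N.
Proof.
by move=> A0; move: ode; rewrite (PE z) => /multiplicity_ordinary; apply.
Qed.

Lemma root_singular A1 z : A = ('X - z%:P) * A1 -> (0 < count_mem z s)%N ->
  ((count_mem z s)%:R - 1) * A1.[z] = - B.[z].
Proof.
move=> AE; move: ode; rewrite AE (PE z).
by move/multiplicity_singular => H /H; apply.
Qed.

(** Stieltjes' electrostatic interpretation: the logarithmic derivative of the
cofactor of [z] is the force exerted on [z] by the other roots. *)
Lemma root_equilibrium z : z \in s -> A.[z] != 0 ->
  2 * A.[z] * \sum_(w <- s) (z - w)^-1 + B.[z] = 0.
Proof.
move=> zs A0.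
have cz : count_mem z s = 1%N.
  by apply/eqP; rewrite eqn_leq root_simple //= -has_count has_pred1.
move: ode; rewrite (PE z) cz expr1 => /equilibrium_at_root.
move=> /(_ (cofactor_neq0 z)) e.
apply: (mulIf (cofactor_neq0 z)); rewrite mul0r; apply: etrans e.
rewrite /cofactor derivZ !hornerZ logarithmic_derivative //.
by rewrite -sum_inv_filter; ring.
Qed.

End roots.
End RootsOfODE.

(** * Modulus and real part *)

Section ComplexPlane.
Variable R : realType.
Local Notation C := R[i].
Implicit Types (x y z u v w : C) (r : R).
Local Notation Re := (@complex.Re R).
Local Notation Im := (@complex.Im R).

Lemma ReD x y : Re (x + y) = Re x + Re y. Proof. by case: x; case: y. Qed.
Lemma ReN x : Re (- x) = - Re x. Proof. by case: x. Qed.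
Lemma ReB x y : Re (x - y) = Re x - Re y. Proof. by rewrite ReD ReN. Qed.
Lemma ImD x y : Im (x + y) = Im x + Im y. Proof. by case: x; case: y. Qed.
Lemma ImN x : Im (- x) = - Im x. Proof. by case: x. Qed.
Lemma ImB x y : Im (x - y) = Im x - Im y. Proof. by rewrite ImD ImN. Qed.
Lemma ReM x y : Re (x * y) = Re x * Re y - Im x * Im y.
Proof. by case: x; case: y. Qed.
Lemma ImM x y : Im (x * y) = Re x * Im y + Im x * Re y.
Proof. by case: x; case: y. Qed.
Lemma Re_rM r z : Re (r%:C * z) = r * Re z.
Proof. by rewrite ReM /= mul0r subr0. Qed.
Lemma Im_rM r z : Im (r%:C * z) = r * Im z.
Proof. by rewrite ImM /= mul0r addr0. Qed.

Lemma Re_sum I (s : seq I) (P : pred I) (F : I -> C) :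
  Re (\sum_(i <- s | P i) F i) = \sum_(i <- s | P i) Re (F i).
Proof. by elim/big_rec2: _ => // i a b _ <-; rewrite ReD. Qed.

Lemma sqr_normc z : normc z ^+ 2 = Re z ^+ 2 + Im z ^+ 2.
Proof. by case: z => a b /=; rewrite sqr_sqrtr // addr_ge0 ?sqr_ge0. Qed.

Lemma normc_ge0 z : 0 <= normc z.
Proof. by case: z => a b; exact: sqrtr_ge0. Qed.

Lemma normc0 : normc (0 : C) = 0. Proof. exact: ComplexField.Normc.normc0. Qed.

Lemma normc_eq0 z : (normc z == 0) = (z == 0).
Proof.
apply/eqP/eqP => [/eq0_normc //|->]; exact: normc0.
Qed.

Lemma normc_gt0 z : (0 < normc z) = (z != 0).
Proof. by rewrite lt_def normc_ge0 andbT normc_eq0. Qed.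

Lemma normcBC x y : normc (x - y) = normc (y - x).
Proof. by rewrite -opprB normcN. Qed.

Lemma normc_real r : normc r%:C = `|r|.
Proof. by rewrite /= expr0n addr0 sqrtr_sqr. Qed.

Lemma normc1 : normc (1 : C) = 1.
Proof. by rewrite (normc_real 1) normr1. Qed.

Lemma normc_rM r z : normc (r%:C * z) = `|r| * normc z.
Proof. by rewrite normcM normc_real. Qed.

Lemma le_normcB x y : normc (x - y) <= normc x + normc y.
Proof. by rewrite -(normcN y); exact: le_normcD. Qed.

Lemma normc_triangle x y z : normc (x - z) <= normc (x - y) + normc (y - z).
Proof. by apply: le_trans (le_normcD _ _); rewrite addrA subrK. Qed.

Lemma lipschitz_normc x y : `|normc x - normc y| <= normc (x - y).
Proof.
rewrite ler_norml; apply/andP; split; last first.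
  by rewrite lerBlDr; apply: le_trans (le_normcD _ _); rewrite subrK.
rewrite lerNl opprB lerBlDr normcBC.
by apply: le_trans (le_normcD _ _); rewrite subrK.
Qed.

Lemma normc_sum I (s : seq I) (P : pred I) (F : I -> C) :
  normc (\sum_(i <- s | P i) F i) <= \sum_(i <- s | P i) normc (F i).
Proof.
elim/big_rec2: _ => [|i a b _ h]; first by rewrite normc0.
by apply: le_trans (le_normcD _ _) _; rewrite lerD2l.
Qed.

Lemma normc_Re z : `|Re z| <= normc z.
Proof.
by rewrite -sqrtr_sqr; case: z => a b /=; rewrite ler_wsqrtr // lerDl sqr_ge0.
Qed.

Lemma normc_Im z : `|Im z| <= normc z.
Proof.
by rewrite -sqrtr_sqr; case: z => a b /=; rewrite ler_wsqrtr // lerDr sqr_ge0.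
Qed.

Lemma normc_le_ReIm z : normc z <= `|Re z| + `|Im z|.
Proof.
rewrite -(@ler_pXn2r _ 2) ?nnegrE ?normc_ge0 ?addr_ge0 //.
rewrite sqr_normc -(real_normK (num_real (Re z))) -(real_normK (num_real (Im z))).
have := normr_ge0 (Re z); have := normr_ge0 (Im z); nra.
Qed.

Lemma normc_norm z : `|z| = (normc z)%:C.
Proof. by case: z. Qed.

Lemma Re_div u z : Re (u / z) = (Re u * Re z + Im u * Im z) / normc z ^+ 2.
Proof. by rewrite sqr_normc; case: z => c d; case: u => a b /=; ring. Qed.

Lemma ReIm_le_normc u v : Re u * Re v + Im u * Im v <= normc u * normc v.
Proof.
case: (leP 0 (Re u * Re v + Im u * Im v)) => [h|h]; last first.
  by rewrite (le_trans (ltW h)) // mulr_ge0 ?normc_ge0.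
rewrite -(@ler_pXn2r _ 2) ?nnegrE ?mulr_ge0 ?normc_ge0 //.
rewrite exprMn !sqr_normc.
have := sqr_ge0 (Re u * Im v - Im u * Re v); nra.
Qed.

(** The quotient [w / z] lies in the closed unit disc, which [u |-> (1 - u)^-1]
maps into the half-plane [2^-1 <= Re]. This bounds from below the radial
component of the force by which [w] pushes [z] away from the origin. *)
Lemma outward_force z w : z != w -> normc w <= normc z ->
  2^-1 <= Re (z / (z - w)).
Proof.
move=> zw wz; have d0 : 0 < normc (z - w) by rewrite normc_gt0 subr_eq0.
rewrite Re_div ler_pdivlMr ?exprn_gt0 // !ReB !ImB sqr_normc !ReB !ImB.
have : normc w ^+ 2 <= normc z ^+ 2 by rewrite ler_pXn2r ?nnegrE ?normc_ge0.
rewrite !sqr_normc; lra.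
Qed.

(** The kernel of the first variation of the energy along the field [h]; the
convention [0^-1 = 0] makes it vanish on the diagonal. *)
Definition variation_kernel (h : C -> C) x y : R := Re ((h x - h y) / (x - y)).

Definition lipschitzc (L : R) (h : C -> C) :=
  forall x y, normc (h x - h y) <= L * normc (x - y).

Lemma variation_kernel_le L h x y : 0 <= L -> lipschitzc L h ->
  normc ((h x - h y) / (x - y)) <= L.
Proof.
move=> L0 hL; have [->|xy] := eqVneq x y.
  by rewrite subrr mul0r normc0.
have d0 : 0 < normc (x - y) by rewrite normc_gt0 subr_eq0.
by rewrite normcM normcV ler_pdivrMr.
Qed.

Lemma norm_variation_kernel L h x y : 0 <= L -> lipschitzc L h ->
  `|variation_kernel h x y| <= L.
Proof.
by move=> L0 hL; apply: le_trans (normc_Re _) (variation_kernel_le _ _ L0 hL).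
Qed.

End ComplexPlane.

(** * Equilibrium and location of the zeros *)

Section Configurations.
Variables (R : realType) (p : nat) (a : 'I_p.+1 -> R[i]) (B : {poly R[i]}).
Hypothesis (ha : injective a) (hB : (size B <= p.+1)%N).
Local Notation C := R[i].
Local Notation Re := (@complex.Re R).
Local Notation A := (\prod_(i < p.+1) ('X - (a i)%:P)).
Implicit Types (s : seq C) (z w : C).

(** The roots [s] of a polynomial solution; [G] stands for the Van Vleck polynomial
multiplied by [n * (n + alpha - 1)]. *)
Definition stationary s := exists G : {poly C},
  let P := \prod_(w <- s) ('X - w%:P) in A * P^`(2) + B * P^`() = G * P.

Lemma heine_stieltjes_stationary n alpha (Q : {poly C}) :
  heine_stieltjes p n alpha A B Q -> size (zeros Q) = n /\ stationary (zeros Q).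
Proof.
move=> [sQ [V [_ _ ode]]].
have := svalP (closed_field_poly_normal Q); rewrite -/(zeros Q); move: (zeros Q) => s.
have Q0 : Q != 0 by rewrite -size_poly_eq0 sQ.
set c := lead_coef Q; set P := \prod_(z <- _) _ => QE.
have c0 : c != 0 by rewrite lead_coef_eq0.
split.
  by apply/eqP; rewrite -eqSS -sQ QE size_scale // /P size_prod_XsubC.
exists ((n%:R * (n%:R + alpha - 1)) *: V); rewrite -/P /=.
move/eqP: ode; rewrite subr_eq0 => /eqP ode.
apply: (scalerI c0); transitivity (A * Q^`(2) + B * Q^`()).
  by rewrite QE derivZ derivnZ -!scalerAr scalerDr.
by rewrite ode QE -!scalerAr -scalerAl !scalerA mulrC.
Qed.

Lemma hornerA z : A.[z] = \prod_(i < p.+1) (z - a i).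
Proof. by rewrite horner_prod; apply: eq_bigr => i _; rewrite hornerXsubC. Qed.

Lemma hornerA_neq0 z : (forall i, z != a i) -> A.[z] != 0.
Proof.
by move=> h; rewrite hornerA; apply/prodf_neq0 => i _; rewrite subr_eq0.
Qed.

Lemma hornerA_eq0 z : A.[z] = 0 -> exists i, z = a i.
Proof.
move/eqP; rewrite hornerA prodf_seq_eq0 => /hasP[i _].
by rewrite /= subr_eq0 => /eqP ->; exists i.
Qed.

Lemma normc_prod I (r : seq I) (P : pred I) (F : I -> C) :
  normc (\prod_(i <- r | P i) F i) = \prod_(i <- r | P i) normc (F i).
Proof.
by elim/big_rec2: _ => [|i x y _ <-]; rewrite ?normc1 ?normcM.
Qed.

Lemma normcX z k : normc (z ^+ k) = normc z ^+ k.
Proof. by elim: k => [|k IH]; rewrite ?expr0 ?normc1 // !exprS normcM IH. Qed.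

Lemma horner_bounded (P : {poly C}) r : 0 <= r ->
  exists2 K, 0 <= K & forall z, normc z <= r -> normc P.[z] <= K.
Proof.
move=> r0; exists (\sum_(k < size P) normc P`_k * r ^+ k).
  by apply: sumr_ge0 => k _; rewrite mulr_ge0 ?normc_ge0 ?exprn_ge0.
move=> z zr; rewrite horner_coef; apply: le_trans (normc_sum _ _ _) _.
apply: ler_sum => k _; rewrite normcM normcX ler_wpM2l ?normc_ge0 //.
by rewrite lerXn2r ?nnegrE ?normc_ge0.
Qed.

(** ['X * B] has at most the degree [p.+1] of [A]. *)
Lemma force_bounded_at_infinity : exists r K : R, 0 <= r /\
  forall z, r <= normc z ->
    A.[z] != 0 /\ normc (z * B.[z]) <= K * normc A.[z].
Proof.
pose r := 2 * (\sum_(i < p.+1) normc (a i)) + 1.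
have S0 : 0 <= \sum_(i < p.+1) normc (a i).
  by apply: sumr_ge0 => i _; exact: normc_ge0.
exists r, ((\sum_(k < size B) normc B`_k) * 2 ^+ p.+1); split=> [|z zr].
  by rewrite /r; lra.
have z1 : 1 <= normc z by apply: le_trans zr; rewrite /r; lra.
have zai i : normc z / 2 <= normc (z - a i).
  have ai : normc (a i) <= \sum_(i < p.+1) normc (a i).
    rewrite (bigD1 i) //= lerDl; apply: sumr_ge0 => j _; exact: normc_ge0.
  have := le_normcD (z - a i) (a i); rewrite subrK; move: zr; rewrite /r; lra.
split.
  apply: hornerA_neq0 => i; rewrite -subr_eq0 -normc_gt0.
  by apply: lt_le_trans (zai i); lra.
rewrite -mulrA normcM mulrC.
have hA : (normc z / 2) ^+ p.+1 <= normc A.[z].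
  rewrite hornerA normc_prod -[in X in X <= _](card_ord p.+1) -prodr_const.
  by apply: ler_prod => i _; rewrite zai andbT divr_ge0 ?normc_ge0.
have hB' : normc B.[z] <= (\sum_(k < size B) normc B`_k) * normc z ^+ p.
  rewrite horner_coef mulr_suml; apply: le_trans (normc_sum _ _ _) _.
  apply: ler_sum => k _; rewrite normcM normcX ler_wpM2l ?normc_ge0 //.
  by rewrite ler_weXn2l // -ltnS (leq_trans (ltn_ord k)).
apply: le_trans (ler_wpM2r (normc_ge0 z) hB') _.
rewrite -!mulrA -exprSr ler_wpM2l //.
  by apply: sumr_ge0 => k _; exact: normc_ge0.
apply: le_trans (ler_wpM2l _ hA); last by rewrite exprn_ge0.
by rewrite -exprMn mulrC divfK.
Qed.

Lemma root_of_maximal_modulus s z0 : z0 \in s ->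
  exists2 z, z \in s & forall w, w \in s -> normc w <= normc z.
Proof.
elim: s z0 => [//|x s IH] z0 _; case: s IH => [_|y s IH].
  by exists x; rewrite ?mem_head // => w; rewrite inE => /eqP ->.
have [z zs hz] := IH y (mem_head _ _).
case: (leP (normc x) (normc z)) => h.
  exists z; first by rewrite inE zs orbT.
  by move=> w; rewrite inE => /orP[/eqP->|/hz].
exists x; first exact: mem_head.
move=> w; rewrite inE => /orP[/eqP->//|/hz wz].
exact: le_trans wz (ltW h).
Qed.

Let stationaryZ s : stationary s -> exists G : {poly C},
  A * (1 *: \prod_(w <- s) ('X - w%:P))^`(2)
  + B * (1 *: \prod_(w <- s) ('X - w%:P))^`() =
  G * (1 *: \prod_(w <- s) ('X - w%:P)).
Proof. by move=> [G h]; exists G; rewrite scale1r. Qed.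

Lemma stationary_equilibrium s z : stationary s -> z \in s -> A.[z] != 0 ->
  2 * A.[z] * \sum_(w <- s) (z - w)^-1 + B.[z] = 0.
Proof.
by move=> /stationaryZ[G h]; exact: (root_equilibrium (oner_neq0 _) h).
Qed.

Lemma stationary_simple s z : stationary s -> A.[z] != 0 ->
  (count_mem z s <= 1)%N.
Proof.
by move=> /stationaryZ[G h]; exact: (root_simple (oner_neq0 _) h).
Qed.

(** The outermost zero is pushed outwards by every other zero, with a total
force of order [n], which the field of [B / A] cannot balance far away. *)
Lemma stationary_bounded : exists r (N : nat), 0 <= r /\
  forall s, stationary s -> (N <= size s)%N -> forall z, z \in s -> normc z <= r.
Proof.
have [r [K [r0 hr]]] := force_bounded_at_infinity.
exists r, (Num.bound `|K|).+2; split=> // s st sN z1 z1s.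
have [z zs hz] := root_of_maximal_modulus z1s.
apply: le_trans (hz _ z1s) _; rewrite leNgt; apply/negP => rz.
have [A0 hAB] := hr _ (ltW rz).
have eqz := stationary_equilibrium st zs A0.
have cz := stationary_simple st A0.
have e : 2 * \sum_(w <- s) Re (z / (z - w)) = - Re (z * B.[z] / A.[z]).
  rewrite -Re_sum -mulr_sumr.
  have -> : B.[z] = - (2 * A.[z] * \sum_(w <- s) (z - w)^-1).
    by apply/eqP; rewrite -addr_eq0 addrC eqz.
  have -> : z * - (2 * A.[z] * (\sum_(w <- s) (z - w)^-1)) / A.[z] =
    - (2 * (z * \sum_(w <- s) (z - w)^-1)) by field.
  by rewrite ReN opprK -[2 : C](rmorph_nat (real_complex R)) Re_rM.
have low : ((size s)%:R - 1) / 2 <= \sum_(w <- s) Re (z / (z - w)).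
  apply: le_trans (_ : \sum_(w <- s) (w != z)%:R / 2 <= _).
    have -> : \sum_(w <- s) (w != z)%:R / 2 =
        (count (predC (pred1 z)) s)%:R / 2 :> R.
      rewrite -mulr_suml -sum1_count natr_sum; congr (_ / _).
      rewrite [RHS]big_mkcond.
      by apply: eq_bigr => w _ /=; case: (w != z).
    rewrite ler_wpM2r // -(count_predC (pred1 z) s) natrD; have : (count_mem z s)%:R <= 1 :> R by rewrite (ler_nat _ _ 1).
    lra.
  rewrite big_seq [leRHS]big_seq; apply: ler_sum => w ws.
  have [->|wz] := eqVneq w z; first by rewrite subrr invr0 mulr0 mul0r.
  by rewrite mul1r; apply: outward_force; [rewrite eq_sym | exact: hz].
have up : - Re (z * B.[z] / A.[z]) <= `|K|.
  apply: le_trans (ler_norm _) _; rewrite normrN.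
  apply: le_trans (normc_Re _) _; rewrite normcM normcV ler_pdivrMr ?normc_gt0 //.
  by apply: le_trans hAB _; rewrite ler_wpM2r ?normc_ge0 // ler_norm.
have := archi_boundP (normr_ge0 K).
have : (Num.bound `|K|).+2%:R <= (size s)%:R :> R by rewrite ler_nat.
rewrite -addn2 natrD; lra.
Qed.

(** The nontrivial exponent of the equation at [a i] depends on [A] and [B] only. *)
Lemma stationary_multiplicity : exists M : nat, forall s z, stationary s ->
  (count_mem z s <= M)%N.
Proof.
pose A1 i := \prod_(j < p.+1 | j != i) ('X - (a j)%:P).
pose f i := Num.bound (normc (B.[a i] / (A1 i).[a i])).
exists (\sum_i f i).+1 => s z st.
have [/eqP/hornerA_eq0[i ->]|A0] := boolP (A.[z] == 0); last first.
  by rewrite (leq_trans (stationary_simple st A0)).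
case mE: (count_mem (a i) s) => [//|m].
rewrite ltnS; apply: leq_trans (_ : f i <= _)%N; last first.
  by rewrite (bigD1 i) //= leq_addr.
have [G h] := stationaryZ st.
have AE : A = ('X - (a i)%:P) * A1 i by rewrite (bigD1 i).
have := root_singular (oner_neq0 _) h AE; rewrite mE => /(_ isT).
rewrite -addn1 natrD addrK => e.
have A10 : (A1 i).[a i] != 0.
  rewrite horner_prod; apply/prodf_neq0 => j ji.
  by rewrite hornerXsubC subr_eq0 (inj_eq ha) eq_sym.
have {}e : m%:R = normc (B.[a i] / (A1 i).[a i]).
  have -> : B.[a i] / (A1 i).[a i] = - (m%:R).
    by rewrite -[B.[_]]opprK -e mulNr mulfK.
  by rewrite normcN -(rmorph_nat (real_complex R)) normc_real normr_nat.
rewrite -(ler_nat R) e; apply/ltW/archi_boundP; exact: normc_ge0.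
Qed.

Lemma separation : exists2 d, 0 < d & forall i j, i != j ->
  d <= normc (a i - a j).
Proof.
exists (\big[Num.min/1]_(ij : 'I_p.+1 * 'I_p.+1 | ij.1 != ij.2)
          normc (a ij.1 - a ij.2)).
  apply: lt_bigmin => // -[i j] /= ij.
  by rewrite normc_gt0 subr_eq0 (inj_eq ha).
move=> i j ij; exact: (@bigmin_le_cond _ _ _ 1 (i, j) (fun k => k.1 != k.2)
  (fun k => normc (a k.1 - a k.2)) ij).
Qed.

(** Only the factor of [A] at the nearest [a i] can be small, and there [h] is
small as well. *)
Lemma field_div_bounded r : 0 <= r -> exists2 K, 0 <= K &
  forall L (h : C -> C), 0 <= L -> lipschitzc L h -> (forall i, h (a i) = 0) ->
  forall z, normc z <= r -> normc (h z * (B.[z] / A.[z])) <= L * K.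
Proof.
move=> r0; have [d d0 hd] := separation; have [K K0 hK] := horner_bounded B r0.
have d20 : 0 < (d / 2) ^+ p by rewrite exprn_gt0 // divr_gt0.
exists (K / (d / 2) ^+ p); first by rewrite divr_ge0 // ltW.
move=> L h L0 hL h0 z zr.
have LK : 0 <= L * (K / (d / 2) ^+ p).
  by rewrite mulr_ge0 // divr_ge0 // ltW.
have [/eqP/hornerA_eq0[i ->]|A0] := boolP (A.[z] == 0).
  by rewrite h0 mul0r normc0.
pose i := [arg min_(i < ord0) normc (z - a i)]%O.
have hi j : normc (z - a i) <= normc (z - a j).
  by rewrite /i; case: arg_minP => // k _; apply.
have zi : 0 < normc (z - a i).
  rewrite normc_gt0; move: A0; rewrite hornerA; apply: contraNneq => zi.
  by rewrite (bigD1 i) //= zi mul0r.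
have hA : normc (z - a i) * (d / 2) ^+ p <= normc A.[z].
  rewrite hornerA (bigD1 i) //= normcM ler_wpM2l ?normc_ge0 // normc_prod.
  have <- : \prod_(j < p.+1 | j != i) (d / 2) = (d / 2) ^+ p.
    by rewrite prodr_const cardC1 card_ord.
  apply: ler_prod => j ji; rewrite divr_ge0 ?(ltW d0) //=.
  have := hd _ _ ji; have := hi j.
  have := le_normcB (z - a i) (z - a j).
  have -> : z - a i - (z - a j) = a j - a i by ring.
  lra.
have nA : 0 < normc A.[z] by rewrite normc_gt0.
rewrite !normcM normcV mulrA ler_pdivrMr //.
apply: le_trans (ler_wpM2l LK hA).
have -> : L * (K / (d / 2) ^+ p) * (normc (z - a i) * (d / 2) ^+ p) =
  L * normc (z - a i) * K by field; rewrite ?gt_eqF //.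
apply: ler_pM; rewrite ?normc_ge0 ?hK //.
by have := hL z (a i); rewrite h0 subr0.
Qed.

(** The equilibrium conditions, multiplied by [h] and summed; exchanging the two
roots in half of the double sum makes the increments of [h] appear. Multiple
roots can only sit at the points [a i], where [h] vanishes. *)
Lemma stationary_variation s (h : C -> C) : stationary s ->
  (forall i, h (a i) = 0) ->
  \sum_(x <- s) \sum_(y <- s) (h x - h y) / (x - y) =
  - \sum_(x <- s) h x * (B.[x] / A.[x]).
Proof.
move=> st h0.
have -> : \sum_(x <- s) \sum_(y <- s) (h x - h y) / (x - y) =
    \sum_(x <- s) (2 * (h x * \sum_(y <- s) (x - y)^-1)).
  pose S := \sum_(x <- s) (h x * \sum_(y <- s) (x - y)^-1).
  transitivity (S + S); last first.
    by rewrite -big_split; apply: eq_bigr => x _; rewrite mulr_natl mulr2n.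
  rewrite {1}/S; under [in X in _ = X + _]eq_bigr do rewrite mulr_sumr.
  have -> : S = \sum_(x <- s) \sum_(y <- s) (- h y / (x - y)).
    rewrite exchange_big; apply: eq_bigr => y _.
    rewrite mulr_sumr; apply: eq_bigr => x _.
    by rewrite -[x - y]opprB invrN mulrNN.
  rewrite -big_split; apply: eq_bigr => x _; rewrite -big_split.
  by apply: eq_bigr => y _ /=; rewrite mulrBl mulNr.
rewrite -sumrN big_seq [RHS]big_seq; apply: eq_bigr => x xs.
have [/eqP/hornerA_eq0[i ->]|A0] := boolP (A.[x] == 0).
  by rewrite h0 !mul0r mulr0 oppr0.
have -> : B.[x] = - (2 * A.[x] * \sum_(w <- s) (x - w)^-1).
  by apply/eqP; rewrite -addr_eq0 addrC stationary_equilibrium.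
by field.
Qed.

Lemma stationary_variation_le r : 0 <= r -> exists2 K, 0 <= K &
  forall s, stationary s -> (forall z, z \in s -> normc z <= r) ->
  forall L (h : C -> C), 0 <= L -> lipschitzc L h -> (forall i, h (a i) = 0) ->
  `|\sum_(x <- s) \sum_(y <- s) variation_kernel h x y| <= (size s)%:R * (L * K).
Proof.
move=> r0; have [K K0 hK] := field_div_bounded r0; exists K => //.
move=> s st sr L h L0 hL h0.
have -> : \sum_(x <- s) \sum_(y <- s) variation_kernel h x y =
    Re (\sum_(x <- s) \sum_(y <- s) (h x - h y) / (x - y)).
  by rewrite Re_sum; apply: eq_bigr => x _; rewrite Re_sum.
apply: le_trans (normc_Re _) _; rewrite stationary_variation // normcN.
apply: le_trans (normc_sum _ _ _) _.
have -> : (size s)%:R * (L * K) = \sum_(x <- s) L * K :> R.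
  by rewrite big_const_seq count_predT iter_addr_0 mulr_natl.
by rewrite big_seq [leRHS]big_seq; apply: ler_sum => x /sr xr; exact: hK.
Qed.

End Configurations.

(** * Counting zeros in small discs *)

Section Huber.
Variable R : realType.
Local Notation C := R[i].
Implicit Types (u v x y : C) (r : R).
Local Notation Re := (@complex.Re R).
Local Notation Im := (@complex.Im R).

(** The gradient of the Huber function, a convex function which is quadratic on
the disc of radius [r] and grows linearly outside of it. *)
Definition huber r u : C := (Num.max (normc u) r)^-1%:C * u.

Lemma normc_huber r u : 0 < r -> normc (huber r u) <= 1.
Proof.
move=> r0; have M0 : 0 < Num.max (normc u) r by rewrite lt_max r0 orbT.
rewrite normc_rM ger0_norm ?invr_ge0 ?(ltW M0) // mulrC ler_pdivrMr // mul1r.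
by rewrite le_max lexx.
Qed.

Lemma lipschitz_maxr (r s t : R) : `|Num.max s r - Num.max t r| <= `|s - t|.
Proof.
rewrite /Num.max; case: ltP => h1; case: ltP => h2; rewrite ?subrr //;
  rewrite !ler_norml; have := ler_norm (s - t); have := ler_norm (t - s);
  rewrite distrC => ? ?; apply/andP; split; lra.
Qed.

Lemma lipschitz_minr (r s t : R) : `|Num.min r s - Num.min r t| <= `|s - t|.
Proof.
rewrite /Num.min; case: ltP => h1; case: ltP => h2; rewrite ?subrr //;
  rewrite !ler_norml; have := ler_norm (s - t); have := ler_norm (t - s);
  rewrite distrC => ? ?; apply/andP; split; lra.
Qed.

Lemma lipschitz_inv_maxr (r s t : R) : 0 < r ->
  `|(Num.max s r)^-1 - (Num.max t r)^-1| <= r^-1 ^+ 2 * `|s - t|.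
Proof.
move=> r0.
have M0 q : 0 < Num.max q r by rewrite lt_max r0 orbT.
have Mr q : (Num.max q r)^-1 <= r^-1 by rewrite lef_pV2 ?posrE // le_max lexx orbT.
have -> : (Num.max s r)^-1 - (Num.max t r)^-1 =
  (Num.max t r - Num.max s r) * ((Num.max s r)^-1 * (Num.max t r)^-1).
  by field; rewrite !gt_eqF.
rewrite normrM mulrC distrC; apply: ler_pM => //; last exact: lipschitz_maxr.
by rewrite ger0_norm ?mulr_ge0 ?invr_ge0 ?(ltW (M0 _)) // expr2 ler_pM ?invr_ge0 ?(ltW (M0 _)).
Qed.

Lemma lipschitz_huber r : 0 < r -> lipschitzc (2 / r) (huber r).
Proof.
move=> r0 u v; rewrite /huber.
set a := Num.max (normc u) r; set b := Num.max (normc v) r.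
have a0 : 0 < a by rewrite lt_max r0 orbT.
have b0 : 0 < b by rewrite lt_max r0 orbT.
have -> : a^-1%:C * u - b^-1%:C * v =
    a^-1%:C * (u - v) + (a^-1 - b^-1)%:C * v.
  by rewrite rmorphB /=; ring.
apply: le_trans (le_normcD _ _) _; rewrite !normc_rM.
have -> : a^-1 - b^-1 = (b - a) * (a^-1 * b^-1) by field; rewrite !gt_eqF.
rewrite ger0_norm ?invr_ge0 ?(ltW a0) // normrM distrC.
rewrite (ger0_norm (_ : 0 <= a^-1 * b^-1)) ?mulr_ge0 ?invr_ge0 ?(ltW a0) ?(ltW b0) //.
have h1 : `|a - b| <= normc (u - v).
  by apply: le_trans (lipschitz_maxr _ _ _) (lipschitz_normc _ _).
have h2 : b^-1 * normc v <= 1 by rewrite mulrC ler_pdivrMr // mul1r le_max lexx.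
have h3 : a^-1 <= r^-1 by rewrite lef_pV2 ?posrE // le_max lexx orbT.
have a1 : 0 <= a^-1 by rewrite invr_ge0 ltW.
have : `|a - b| * (a^-1 * b^-1) * normc v <= normc (u - v) * a^-1.
  rewrite mulrA -mulrA -[leRHS]mulr1; apply: ler_pM => //.
  - by rewrite mulr_ge0.
  - by rewrite mulr_ge0 ?invr_ge0 ?(ltW b0) ?normc_ge0.
  - by rewrite ler_wpM2r.
have : normc (u - v) * a^-1 <= normc (u - v) * r^-1.
  by rewrite ler_wpM2l ?normc_ge0.
lra.
Qed.

(** By Cauchy-Schwarz this reduces to the monotonicity of [t / max (t, r)] in the
modulus [t]. *)
Lemma huber_monotone r u v : 0 < r -> 0 <= Re ((huber r u - huber r v) / (u - v)).
Proof.
move=> r0; rewrite Re_div divr_ge0 ?exprn_ge0 ?normc_ge0 // /huber.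
set a := Num.max (normc u) r; set b := Num.max (normc v) r.
have a0 : 0 < a by rewrite lt_max r0 orbT.
have b0 : 0 < b by rewrite lt_max r0 orbT.
rewrite !ReB !ImB !Re_rM !Im_rM.
have -> : (a^-1 * Re u - b^-1 * Re v) * (Re u - Re v) +
    (a^-1 * Im u - b^-1 * Im v) * (Im u - Im v) =
    a^-1 * normc u ^+ 2 + b^-1 * normc v ^+ 2
    - (a^-1 + b^-1) * (Re u * Re v + Im u * Im v).
  by rewrite !sqr_normc; ring.
have h := ReIm_le_normc u v.
have {}h : (a^-1 + b^-1) * (Re u * Re v + Im u * Im v) <=
    (a^-1 + b^-1) * (normc u * normc v).
  by rewrite ler_wpM2l // addr_ge0 ?invr_ge0 ?ltW.
suff : 0 <= (normc u - normc v) * (a^-1 * normc u - b^-1 * normc v) by lra.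
have nu := normc_ge0 u; have nv := normc_ge0 v.
have -> : a^-1 * normc u - b^-1 * normc v =
    (b * normc u - a * normc v) * (a^-1 * b^-1) by field; rewrite !gt_eqF.
rewrite mulrA; apply: mulr_ge0; last first.
  by rewrite mulr_ge0 ?invr_ge0 ?(ltW a0) ?(ltW b0).
rewrite /a /b /Num.max.
case: (ltP (normc u) r) => h1; case: (ltP (normc v) r) => h2 /=.
- rewrite -mulrBr mulrCA -expr2; by rewrite mulr_ge0 ?sqr_ge0 // ltW.
- have -> : (normc u - normc v) * (normc v * normc u - r * normc v) =
    normc v * ((normc v - normc u) * (r - normc u)) by ring.
  by rewrite mulr_ge0 // mulr_ge0 // subr_ge0 ltW // (lt_le_trans h1).
- have -> : (normc u - normc v) * (r * normc u - normc u * normc v) =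
    normc u * ((normc u - normc v) * (r - normc v)) by ring.
  by rewrite mulr_ge0 // mulr_ge0 // subr_ge0 ltW // (lt_le_trans h2).
- by rewrite (mulrC (normc v)) subrr mulr0.
Qed.

Lemma huber_inner r u v : normc u <= r -> normc v <= r ->
  huber r u - huber r v = r^-1%:C * (u - v).
Proof. by move=> ur vr; rewrite /huber !max_r // -mulrBr. Qed.

Definition tent (d : R) (c x : C) : R := Num.max (1 - normc (x - c) / d) 0.

Lemma tent_ge0 d c x : 0 <= tent d c x.
Proof. by rewrite le_max lexx orbT. Qed.

Lemma tent_center d c : tent d c c = 1.
Proof. by rewrite /tent subrr normc0 mul0r subr0 max_l. Qed.

Lemma tent_out d c x : 0 < d -> d <= normc (x - c) -> tent d c x = 0.
Proof. by move=> d0 h; rewrite /tent max_r // subr_le0 ler_pdivlMr // mul1r. Qed.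

Lemma lipschitz_tent d c x y : 0 < d ->
  `|tent d c x - tent d c y| <= d^-1 * normc (x - y).
Proof.
move=> d0; apply: le_trans (lipschitz_maxr _ _ _) _.
have -> : 1 - normc (x - c) / d - (1 - normc (y - c) / d) =
  (normc (y - c) - normc (x - c)) * d^-1 by ring.
rewrite normrM [X in _ * X]ger0_norm ?invr_ge0 ?(ltW d0) // mulrC.
rewrite ler_wpM2l ?invr_ge0 ?(ltW d0) // distrC.
apply: le_trans (lipschitz_normc _ _) _.
by rewrite opprB addrA subrK.
Qed.

Lemma lipschitzcB L1 L2 (f g : C -> C) : lipschitzc L1 f -> lipschitzc L2 g ->
  lipschitzc (L1 + L2) (fun x => f x - g x).
Proof.
move=> hf hg x y; rewrite mulrDl.
have -> : f x - g x - (f y - g y) = (f x - f y) - (g x - g y) by ring.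
by apply: le_trans (le_normcB _ _) _; rewrite lerD.
Qed.

Lemma variation_kernelB (f g : C -> C) x y :
  variation_kernel (fun z => f z - g z) x y =
  variation_kernel f x y - variation_kernel g x y.
Proof.
rewrite /variation_kernel -ReB -mulrBl; congr (Re (_ / _)); ring.
Qed.

End Huber.

Section Counting.
Variables (R : realType) (p : nat) (a : 'I_p.+1 -> R[i]) (B : {poly R[i]}).
Hypothesis ha : injective a.
Local Notation C := R[i].
Implicit Types (s : seq C) (z w : C).

Let interpolant d r z0 x : C :=
  \sum_(i < p.+1) (tent d (a i) x)%:C * huber r (a i - z0).

Let lipschitz_interpolant d r z0 : 0 < d -> 0 < r ->
  lipschitzc (p.+1%:R / d) (interpolant d r z0).
Proof.
move=> d0 r0 x y; rewrite /interpolant -sumrB.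
apply: le_trans (normc_sum _ _ _) _.
have -> : p.+1%:R / d * normc (x - y) =
    \sum_(i < p.+1) (d^-1 * normc (x - y)).
  by rewrite sumr_const card_ord -mulr_natl; ring.
apply: ler_sum => i _; rewrite -mulrBl -rmorphB normc_rM.
rewrite -[leRHS]mulr1; apply: ler_pM; rewrite ?normc_ge0 ?normc_huber //.
exact: lipschitz_tent.
Qed.

Lemma sum_count (P : pred C) s : \sum_(x <- s) (P x)%:R = (count P s)%:R :> R.
Proof.
rewrite -sum1_count natr_sum [RHS]big_mkcond; apply: eq_bigr => x _ /=.
by case: (P x).
Qed.

(** The mutual repulsion of the zeros in a disc of radius [r] is at least
[1 / r] for each pair, as measured by the Huber field. Subtracting an
interpolating field makes it vanish at the [a i], after which the equilibrium
conditions bound the total repulsion by the square of the number of zeros. *)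
Lemma stationary_count_disc r0 : 0 <= r0 -> exists2 K, 0 <= K &
  forall s, stationary a B s -> (forall z, z \in s -> normc z <= r0) ->
  forall z0 r, 0 < r ->
  (count (fun z => normc (z - z0) <= r) s)%:R ^+ 2 <=
    K * (r * (size s)%:R ^+ 2 + (size s)%:R).
Proof.
move=> r00; have [d d0 hd] := separation ha.
have [K K0 hK] := stationary_variation_le B ha r00.
have [M hM] := stationary_multiplicity B ha.
pose l : R := p.+1%:R / d.
have l0 : 0 <= l by rewrite divr_ge0 // ltW.
exists (M%:R + 2 * K + l * K + l).
  have := ler0n R M; have := mulr_ge0 l0 K0; lra.
move=> s st sr z0 r rp; set P := fun z => _ <= r; set n := (size s)%:R.
pose H x := huber r (x - z0); pose g := interpolant d r z0.
have lH : lipschitzc (2 / r) H.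
  move=> x y; apply: le_trans (lipschitz_huber rp _ _) _.
  by rewrite opprB addrA subrK.
have lg : lipschitzc l g by exact: lipschitz_interpolant.
have r20 : 0 <= 2 / r by rewrite divr_ge0 // ltW.
have hg i : H (a i) - g (a i) = 0.
  rewrite /g /interpolant (bigD1 i) //= tent_center mul1r big1 ?addr0 ?subrr //.
  by move=> j ji; rewrite tent_out ?mul0r // hd // eq_sym.
have := hK s st sr _ _ (addr_ge0 r20 l0) (lipschitzcB lH lg) hg.
have -> : \sum_(x <- s) \sum_(y <- s)
    variation_kernel (fun z => H z - g z) x y =
    \sum_(x <- s) \sum_(y <- s) variation_kernel H x y -
    \sum_(x <- s) \sum_(y <- s) variation_kernel g x y.
  rewrite -sumrB; apply: eq_bigr => x _; rewrite -sumrB; apply: eq_bigr => y _.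
  exact: variation_kernelB.
have -> : (size s)%:R = n by [].
have sg : \sum_(x <- s) \sum_(y <- s) variation_kernel g x y <= n ^+ 2 * l.
  have -> : n ^+ 2 * l = \sum_(x <- s) \sum_(y <- s) l :> R.
    by rewrite !big_const_seq !count_predT !iter_addr_0 expr2 -mulrA !mulr_natl.
  apply: ler_sum => x _; apply: ler_sum => y _.
  by apply: le_trans (ler_norm _) (norm_variation_kernel _ _ l0 lg).
(* The kernel is 0 rather than r^-1 on coincident pairs, whose number is at most
   M times the number of roots. *)
have sH : r^-1 * ((count P s)%:R ^+ 2 - M%:R * n) <=
    \sum_(x <- s) \sum_(y <- s) variation_kernel H x y.
  apply: le_trans (_ : r^-1 * \sum_(x <- s) \sum_(y <- s)
      ((P x)%:R * (P y)%:R - (x == y)%:R) <= _).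
    rewrite ler_wpM2l ?invr_ge0 ?(ltW rp) //.
    have -> : \sum_(x <- s) \sum_(y <- s) ((P x)%:R * (P y)%:R - (x == y)%:R) =
        (count P s)%:R ^+ 2 - \sum_(x <- s) (count_mem x s)%:R :> R.
      rewrite -sum_count expr2 mulr_suml -sumrB; apply: eq_bigr => x _.
      rewrite sumrB mulr_sumr -(sum_count (pred1 x)); congr (_ - _).
      by apply: eq_bigr => y _; rewrite /= eq_sym.
    rewrite lerD2l lerN2.
    have -> : M%:R * n = \sum_(x <- s) M%:R :> R.
      by rewrite big_const_seq count_predT iter_addr_0 mulr_natr.
    by apply: ler_sum => x _; rewrite ler_nat hM.
  rewrite mulr_sumr; apply: ler_sum => x _; rewrite mulr_sumr.
  apply: ler_sum => y _.
  have [->|xy] := eqVneq x y.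
    rewrite /variation_kernel subrr mul0r /=.
    apply: mulr_ge0_le0; first by rewrite invr_ge0 ltW.
    by case: (P y) => /=; rewrite ?mulr1 ?mulr0 ?subrr // sub0r oppr_le0 ler01.
  have Hxy := huber_monotone (x - z0) (y - z0) rp.
  rewrite opprB addrA subrK -/(H x) -/(H y) in Hxy.
  rewrite subr0; case Px : (P x); last by rewrite mul0r mulr0.
  case Py : (P y); last by rewrite !mulr0.
  rewrite /variation_kernel /H huber_inner // opprB addrA subrK mulfK ?subr_eq0 //.
  by rewrite !mulr1.
rewrite ler_norml => /andP[_ h].
have {}h : r^-1 * ((count P s)%:R ^+ 2 - M%:R * n) <=
  n ^+ 2 * l + n * ((2 / r + l) * K) by lra.
move: h; rewrite mulrC ler_pdivrMr // => h.
have n0 : 0 <= n by rewrite ler0n.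
have nn : n <= n ^+ 2.
  rewrite /n; case: (size s) => [|k]; first by rewrite expr0n.
  by rewrite expr2 ler_peMl // ler1n.
have e : (n ^+ 2 * l + n * ((2 / r + l) * K)) * r =
  l * (r * n ^+ 2) + 2 * K * n + l * K * (r * n) by field; rewrite gt_eqF.
rewrite e in h; rewrite mulrDr.
have : l * K * (r * n) <= l * K * (r * n ^+ 2).
  apply: ler_wpM2l; first exact: mulr_ge0.
  by apply: ler_wpM2l nn; exact: ltW.
have : 0 <= (M%:R + 2 * K) * (r * n ^+ 2).
  apply: mulr_ge0; last by rewrite mulr_ge0 ?exprn_ge0 // ltW.
  by rewrite addr_ge0 ?ler0n // mulr_ge0.
have : 0 <= (l * K + l) * n.
  by apply: mulr_ge0 => //; apply: addr_ge0 => //; exact: mulr_ge0.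
lra.
Qed.

End Counting.

(** * Topology and Borel sets of the complex plane *)

Section Topology.
Variable R : realType.
Local Notation C := R[i].
Local Notation Re := (@complex.Re R).
Local Notation Im := (@complex.Im R).
Implicit Types (z w : C) (r : R).

(** The radius of a ball in [R[i]] is itself an element of [R[i]], which is real
because it is positive. *)
Lemma nbhs_normcP z (S : set C) : nbhs z S <->
  exists2 e : R, 0 < e & forall w, normc (z - w) < e -> S w.
Proof.
split=> [/nbhs_ballP[e /= e0 he]|[e e0 he]].
  have eE : e = (Re e)%:C by move: e0; rewrite ltcE; case: (e) => ? ? /= /andP[/eqP->].
  have e0' : 0 < Re e by move: e0; rewrite {1}eE ltcR.
  exists (Re e) => // w hw; apply: he; rewrite /ball /= normc_norm eE ltcR //.
apply/nbhs_ballP; exists e%:C; first by rewrite /= ltcR.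
by move=> w; rewrite /ball /= normc_norm ltcR => /he.
Qed.

Lemma lipschitz_continuous_C (f : C -> C) L :
  (forall x y, normc (f x - f y) <= L * normc (x - y)) -> continuous f.
Proof.
move=> hf z S /nbhs_normcP[e e0 he]; apply/nbhs_normcP.
have L0 : 0 < `|L| + 1 by rewrite ltr_wpDl.
exists (e / (`|L| + 1)); first by rewrite divr_gt0.
move=> w; rewrite ltr_pdivlMr // => zw; apply: he.
apply: le_lt_trans (hf _ _) _; apply: le_lt_trans zw; rewrite mulrC.
by rewrite ler_wpM2l ?normc_ge0 // (le_trans (ler_norm _)) // lerDl.
Qed.

Lemma lipschitz_continuous_R (f : C -> R) L :
  (forall x y, `|f x - f y| <= L * normc (x - y)) -> continuous f.
Proof.
move=> hf z S /nbhs_ballP[e /= e0 he]; apply/nbhs_normcP.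
have L0 : 0 < `|L| + 1 by rewrite ltr_wpDl.
exists (e / (`|L| + 1)); first by rewrite divr_gt0.
move=> w; rewrite ltr_pdivlMr // => zw; apply: he; rewrite /ball /=.
apply: le_lt_trans (hf _ _) _; apply: le_lt_trans zw; rewrite mulrC.
by rewrite ler_wpM2l ?normc_ge0 // (le_trans (ler_norm _)) // lerDl.
Qed.

Lemma continuous_Re : continuous (Re : C -> R).
Proof.
apply: (@lipschitz_continuous_R _ 1) => x y.
by rewrite -ReB mul1r normc_Re.
Qed.

Lemma continuous_Im : continuous (Im : C -> R).
Proof.
apply: (@lipschitz_continuous_R _ 1) => x y.
by rewrite -ImB mul1r normc_Im.
Qed.

Lemma continuous_mulR (f g : C -> R) : continuous f -> continuous g ->
  continuous (fun x => f x * g x).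
Proof. by move=> cf cg x; exact: (cvgM (cf x) (cg x)). Qed.

Lemma continuous_subR (f g : C -> R) : continuous f -> continuous g ->
  continuous (fun x => f x - g x).
Proof. by move=> cf cg x; exact: (cvgB (cf x) (cg x)). Qed.

Lemma open_measurable_C (U : set C) : open U -> measurable U.
Proof. exact: sub_sigma_algebra. Qed.

Lemma closed_measurable_C (U : set C) : closed U -> measurable U.
Proof.
move=> cU; rewrite -[U]setCK; apply: measurableC; apply: open_measurable_C.
exact: closed_openC.
Qed.

Lemma continuous_measurable_C (f : C -> R) : continuous f ->
  measurable_fun [set: C] f.
Proof.
move=> /continuousP cf; apply: (measurability _ (RGenOpens.measurableE R)) => //.
move=> _ [_ [a [b ->] <-]]; rewrite setTI; apply: open_measurable_C.
exact/cf/interval_open.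
Qed.

Lemma continuous_measurable_EFin (f : C -> R) : continuous f ->
  measurable_fun [set: C] (fun x => (f x)%:E).
Proof. by move=> cf; apply/measurable_EFinP; exact: continuous_measurable_C. Qed.

Lemma continuous_measurable_CC (f : C -> C) : continuous f ->
  measurable_fun [set: C] f.
Proof.
move=> /continuousP cf; apply: (@measurability _ _ C C setT f (@open C)) => //.
by move=> _ [U oU <-]; rewrite setTI; apply: open_measurable_C; exact: cf.
Qed.

Lemma open_disc z r : open [set w | normc (w - z) < r].
Proof.
have : continuous (fun w => normc (w - z)).
  apply: (@lipschitz_continuous_R _ 1) => x y; rewrite mul1r.
  by apply: le_trans (lipschitz_normc _ _) _; rewrite opprB addrA subrK.
move=> /continuousP /(_ [set t : R | t < r]); apply.
exact: open_lt.
Qed.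

Lemma closed_disc z r : closed [set w | normc (w - z) <= r].
Proof.
have : continuous (fun w => normc (w - z)).
  apply: (@lipschitz_continuous_R _ 1) => x y; rewrite mul1r.
  by apply: le_trans (lipschitz_normc _ _) _; rewrite opprB addrA subrK.
move=> cf; apply: (@closed_comp _ _ (fun w => normc (w - z)) [set t : R | t <= r]).
  by move=> w _; exact: cf.
exact: closed_le.
Qed.

Lemma compact_disc r : compact [set w : C | normc w <= r].
Proof.
pose f (q : R * R) : C := q.1 +i* q.2.
pose K : set (R * R) := `[- r, r]%classic `*` `[- r, r]%classic.
have cK : compact K by apply: compact_setX; exact: segment_compact.
have cf : continuous f.
  move=> q S /nbhs_normcP[e e0 he].
  have e20 : 0 < e / 2 by rewrite divr_gt0.
  exists (ball q.1 (e / 2), ball q.2 (e / 2)).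
    by split; apply: nbhsx_ballx.
  move=> [x y] [/= hx hy]; apply: he; apply: le_lt_trans (normc_le_ReIm _) _.
  by rewrite /f /=; move: hx hy; rewrite /ball /=; lra.
apply: (@subclosed_compact _ _ (f @` K)).
- rewrite (_ : [set _ | _] = [set w | normc (w - 0) <= r]); first exact: closed_disc.
  by apply/seteqP; split=> w /=; rewrite subr0.
- by apply: continuous_compact => //; exact: continuous_subspaceT.
move=> w /= wr; exists (Re w, Im w); last by case: w {wr}.
split; rewrite /= in_itv /= -ler_norml.
  exact: le_trans (normc_Re _) wr.
exact: le_trans (normc_Im _) wr.
Qed.

Lemma continuous_bounded_disc (f : C -> R) r : continuous f ->
  exists2 M, 0 < M & forall z, normc z <= r -> `|f z| <= M.
Proof.
move=> cf; have cfK : compact (f @` [set w | normc w <= r]).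
  apply: continuous_compact; last exact: compact_disc.
  exact: continuous_subspaceT.
have [M [_ hM]] := compact_bounded cfK.
exists (Num.max M 0 + 1); first by rewrite ltr_pwDr // le_max lexx orbT.
move=> z zr; apply: hM; last by exists z.
by rewrite ltr_pwDr // le_max lexx.
Qed.

Lemma compact_bounded_closed (S : set C) r : closed S ->
  (forall z, S z -> normc z <= r) -> compact S.
Proof. by move=> cS hS; exact: subclosed_compact cS (@compact_disc r) hS. Qed.

Lemma compact_support_disc (f : C -> R) r :
  (forall z, r < normc z -> f z = 0) ->
  compact (closure [set z | f z != 0]).
Proof.
move=> hf; apply: (@compact_bounded_closed _ r); first exact: closed_closure.
have -> : (forall z, closure [set z | f z != 0] z -> normc z <= r) =
  (closure [set z | f z != 0] `<=` [set z | normc (z - 0) <= r]).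
  by apply/propext; split=> h z /h /=; rewrite subr0.
have /closure_id e := @closed_disc 0 r.
rewrite [X in _ `<=` X]e.
apply: closure_subset => z /=; rewrite subr0 leNgt.
by apply: contraNN => /hf ->.
Qed.

End Topology.

Section Measurability.
Variable R : realType.
Local Notation C := R[i].
Local Notation Re := (@complex.Re R).
Local Notation Im := (@complex.Im R).
Context d (T : measurableType d).
Implicit Types f g : T -> C.

Lemma measurable_Re f : measurable_fun setT f -> measurable_fun setT (fun x => Re (f x)).
Proof.
by move=> mf; apply: (measurableT_comp (continuous_measurable_C (@continuous_Re R))).
Qed.

Lemma measurable_Im f : measurable_fun setT f -> measurable_fun setT (fun x => Im (f x)).
Proof.
by move=> mf; apply: (measurableT_comp (continuous_measurable_C (@continuous_Im R))).
Qed.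

Lemma measurable_sqr_normcB f g : measurable_fun setT f -> measurable_fun setT g ->
  measurable_fun setT (fun x => normc (f x - g x) ^+ 2).
Proof.
move=> mf mg.
rewrite (_ : (fun x => _) = (fun x => (Re (f x) - Re (g x)) ^+ 2
   + (Im (f x) - Im (g x)) ^+ 2)); last first.
  by apply/funext => x; rewrite sqr_normc ReB ImB.
by apply: measurable_funD; apply: measurable_funX; apply: measurable_funB;
  do ?[exact: measurable_Re | exact: measurable_Im].
Qed.

Lemma measurable_normcB f g : measurable_fun setT f -> measurable_fun setT g ->
  measurable_fun setT (fun x => normc (f x - g x)).
Proof.
move=> mf mg.
rewrite (_ : (fun x => _) = (fun x => Num.sqrt (normc (f x - g x) ^+ 2))); last first.
  by apply/funext => x; rewrite sqrtr_sqr ger0_norm // normc_ge0.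
apply: (measurableT_comp (continuous_measurable_fun (@sqrt_continuous R))).
exact: measurable_sqr_normcB.
Qed.

End Measurability.

(** * Nonnegative charges *)

Section Charges.
Context d (T : measurableType d) (R : realType).
Variable nu : {charge set T -> \bar R}.
Hypothesis nu_ge0 : forall S, measurable S -> (0 <= nu S)%E.

Let hahn := hahn_posnegP nu.

(** The negative set of a Hahn decomposition need not be empty, but it is null. *)
Lemma jordan_neg_nonneg S : measurable S -> jordan_neg hahn S = 0%E.
Proof.
move=> mS; have [_ [mN neg] _ _] := hahn.
rewrite jordan_negE cjordan_negE /crestr0 mem_set // /crestr.
have mSN : measurable (S `&` hahn_neg nu) by exact: measurableI.
have le0 := neg _ mSN (@subIsetr _ _ _).
by apply/eqP; rewrite oppe_eq0 eq_le le0 nu_ge0.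
Qed.

Lemma jordan_pos_nonneg S : measurable S -> jordan_pos hahn S = nu S.
Proof.
move=> mS; rewrite [RHS](jordan_decomp hahn mS) /cadd; rewrite -[LHS]adde0; congr (_ + _)%E.
by rewrite -[RHS]/((-1)%:E * jordan_neg hahn S)%E jordan_neg_nonneg // mule0.
Qed.

Lemma total_variation_nonneg S : measurable S -> Defs.total_variation nu S = nu S.
Proof.
move=> mS; rewrite -(jordan_pos_nonneg mS) -[RHS]adde0.
by congr (_ + _)%E; exact: jordan_neg_nonneg.
Qed.

Lemma charge_integral_nonneg (m : {measure set T -> \bar R}) f :
  (forall S, measurable S -> nu S = m S) ->
  charge_integral nu f = (\int[m]_x f x)%E.
Proof.
move=> num; rewrite /charge_integral.
rewrite [X in (_ - X)%E](@eq_measure_integral _ _ _ _ mzero); last first.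
  by move=> S mS _; exact: jordan_neg_nonneg.
rewrite integral_measure_zero oppe0 adde0.
apply: eq_measure_integral => S mS _; rewrite -num //.
exact: jordan_pos_nonneg.
Qed.

End Charges.

(** * Density of continuous functions in L1 *)

Section Approximation.
Variable R : realType.
Local Notation C := R[i].
Variable nu : {measure set C -> \bar R}.
Hypothesis nu_fin : (nu setT < +oo)%E.
Implicit Types (S : set C) (f g : C -> R).

Lemma bounded_cvg_L1 (f_ : nat -> C -> R) f :
  (forall n, measurable_fun setT (f_ n)) -> measurable_fun setT f ->
  (forall n x, `|f_ n x| <= 1) -> (forall x, f_ ^~ x @ \oo --> f x) ->
  forall e : R, 0 < e ->
  exists n, (\int[nu]_x (`|f_ n x - f x|)%:E <= e%:E)%E.
Proof.
move=> mf_ mf f1 fcvg e e0.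
have [] := @dominated_convergence _ _ _ nu setT measurableT
  (fun n => EFin \o f_ n) (EFin \o f) (cst 1%:E).
- by move=> n; apply/measurable_EFinP.
- exact/measurable_EFinP.
- by apply: aeW => x _; apply/fine_cvgP; split; [exact: nearW | exact: fcvg].
- apply/integrableP; split; first exact: measurable_cst.
  under eq_integral do rewrite /= normr1.
  by rewrite integral_cst // mul1e.
- by apply: aeW => x n _ /=; rewrite lee_fin.
move=> _ + _; move=> /fine_cvgP[fin /cvgrPdist_lt /(_ e e0) lim].
near \oo => n; exists n.
have finn : (\int[nu]_x `|(EFin \o f_ n) x - (EFin \o f) x|)%E \is a fin_num.
  by near: n.
have : `|0 - fine (\int[nu]_x `|(EFin \o f_ n) x - (EFin \o f) x|)%E| < e.
  by near: n.
rewrite sub0r normrN => /(le_lt_trans (ler_norm _)) h.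
by apply: ltW; rewrite -(fineK finn) lte_fin.
Unshelve. all: by end_near. Qed.

Let distances (F : set C) z : set R :=
  [set 1] `|` [set normc (z - w) | w in F].

(** The element [1] keeps the set of distances nonempty when [F] is empty. *)
Definition dist1 (F : set C) z : R := inf (distances F z).

Let dist1_has_inf F z : has_inf (distances F z).
Proof.
split; first by exists 1; left.
by exists 0 => _ [->|[w _ <-]] //; exact: normc_ge0.
Qed.

Lemma dist1_ge0 F z : 0 <= dist1 F z.
Proof.
apply: lb_le_inf; first by exists 1; left.
by move=> _ [->|[w _ <-]] //; exact: normc_ge0.
Qed.

Lemma dist1_le1 F z : dist1 F z <= 1.
Proof. by apply: ge_inf; [exact: (dist1_has_inf F z).2 | left]. Qed.

Lemma dist1_in (F : set C) z : F z -> dist1 F z = 0.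
Proof.
move=> Fz; apply/eqP; rewrite eq_le dist1_ge0 andbT.
apply: ge_inf; first exact: (dist1_has_inf F z).2.
by right; exists z => //; rewrite subrr normc0.
Qed.

Lemma dist1_out (F : set C) z : closed F -> ~ F z -> 0 < dist1 F z.
Proof.
move=> cF Fz.
have : nbhs z (~` F) by apply: open_nbhs_nbhs; split => //; exact: closed_openC.
move=> /nbhs_normcP[e e0 he].
have m0 : 0 < Num.min e 1 by rewrite lt_min e0 ltr01.
apply: lt_le_trans m0 _.
apply: lb_le_inf; first by exists 1; left.
move=> _ [->|[w Fw <-]]; first by rewrite ge_min lexx orbT.
by rewrite ge_min leNgt; apply/orP; left; apply/negP => /he.
Qed.

Lemma lipschitz_dist1 F x y : `|dist1 F x - dist1 F y| <= 1 * normc (x - y).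
Proof.
have key u v : dist1 F u - normc (u - v) <= dist1 F v.
  apply: lb_le_inf; first by exists 1; left.
  have h t : distances F u t -> dist1 F u <= t.
    by apply: ge_inf; exact: (dist1_has_inf F u).2.
  move=> _ [->|[w Fw <-]].
    by rewrite lerBlDr (le_trans (dist1_le1 _ _)) // lerDl normc_ge0.
  rewrite lerBlDr addrC; apply: le_trans (normc_triangle u v w).
  by apply: h; right; exists w.
have := key x y; have := key y x; rewrite (normcBC y x) mul1r => h1 h2.
rewrite ler_norml; apply/andP; split; lra.
Qed.

Definition plateau (r : R) (z : C) : R := Num.min 1 (Num.max (r + 1 - normc z) 0).

Lemma plateau_ge0 r z : 0 <= plateau r z.
Proof. by rewrite /plateau le_min ler01 le_max lexx orbT. Qed.

Lemma plateau_le1 r z : plateau r z <= 1.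
Proof. by rewrite /plateau ge_min lexx. Qed.

Lemma plateau_in r z : normc z <= r -> plateau r z = 1.
Proof. by move=> h; rewrite /plateau min_l // le_max; apply/orP; left; lra. Qed.

Lemma plateau_out r z : r + 1 < normc z -> plateau r z = 0.
Proof.
move=> h; rewrite /plateau (@max_r _ _ _ 0); last by rewrite subr_le0 ltW.
by rewrite min_r.
Qed.

Lemma continuous_plateau r : continuous (plateau r).
Proof.
apply: (@lipschitz_continuous_R _ _ 1) => x y; rewrite mul1r.
apply: le_trans (lipschitz_normc _ _).
apply: le_trans (lipschitz_minr _ _ _) _; apply: le_trans (lipschitz_maxr _ _ _) _.
by rewrite opprD addrACA subrr add0r opprK addrC distrC.
Qed.

Definition test_function f := [/\ continuous f, forall z, 0 <= f z <= 1 &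
  exists r, forall z, r < normc z -> f z = 0].

Let L1_approximable S := measurable S /\ forall e : R, 0 < e ->
  exists2 f, test_function f & (\int[nu]_x (`|\1_S x - f x|)%:E <= e%:E)%E.

Let mtest f : test_function f -> measurable_fun setT f.
Proof. by move=> [cf _ _]; exact: continuous_measurable_C. Qed.

Let mindic S : measurable S -> measurable_fun setT (\1_S : C -> R).
Proof. by move=> mS; exact: measurable_indic. Qed.

Let mdist f g : measurable_fun setT f -> measurable_fun setT g ->
  measurable_fun setT (fun x => (`|f x - g x|)%:E).
Proof.
move=> mf mg; apply/measurable_EFinP; apply: measurableT_comp => //.
exact: measurable_funB.
Qed.

Let L1_le f1 g1 f2 g2 f3 g3 (e : R) :
  measurable_fun setT f1 -> measurable_fun setT g1 ->
  measurable_fun setT f2 -> measurable_fun setT g2 ->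
  measurable_fun setT f3 -> measurable_fun setT g3 ->
  (forall x, `|f1 x - g1 x| <= `|f2 x - g2 x| + `|f3 x - g3 x|) ->
  (\int[nu]_x (`|f2 x - g2 x|)%:E <= (e / 2)%:E)%E ->
  (\int[nu]_x (`|f3 x - g3 x|)%:E <= (e / 2)%:E)%E ->
  (\int[nu]_x (`|f1 x - g1 x|)%:E <= e%:E)%E.
Proof.
move=> mf1 mg1 mf2 mg2 mf3 mg3 h h2 h3.
apply: (@le_trans _ _
  (\int[nu]_x ((`|f2 x - g2 x|)%:E + (`|f3 x - g3 x|)%:E))%E).
  apply: ge0_le_integral => //.
  - exact: mdist.
  - by apply: emeasurable_funD; exact: mdist.
  - by move=> x _; rewrite -EFinD lee_fin.
rewrite ge0_integralD //; try exact: mdist.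
by rewrite [e in leRHS]splitr EFinD leeD.
Qed.

Let approximable_open (U : set C) : open U -> L1_approximable U.
Proof.
move=> oU; split; first exact: open_measurable_C.
move=> e e0; pose F := ~` U.
have cF : closed F by rewrite closedC.
pose f_ n z := plateau n%:R z * Num.min 1 (n%:R * dist1 F z).
have min1 n z : 0 <= Num.min 1 (n%:R * dist1 F z) <= 1.
  by rewrite le_min ler01 mulr_ge0 ?dist1_ge0 //= ge_min lexx.
have f01 n z : 0 <= f_ n z <= 1.
  have /andP[? ?] := min1 n z.
  by rewrite mulr_ge0 ?plateau_ge0 //= mulr_ile1 ?plateau_ge0 ?plateau_le1.
have cf n : continuous (f_ n).
  move=> z; apply: continuousM; first exact: continuous_plateau.
  move: z; apply: (@lipschitz_continuous_R _ _ n%:R) => x y.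
  apply: (@le_trans _ _ `|n%:R * dist1 F x - n%:R * dist1 F y|).
    exact: lipschitz_minr.
  rewrite -mulrBr normrM ger0_norm // ler_wpM2l //.
  by have := lipschitz_dist1 F x y; rewrite mul1r.
have [||||n hn] := @bounded_cvg_L1 f_ \1_U _ _ _ _ e e0.
- by move=> n; exact: continuous_measurable_C.
- apply: mindic. exact: open_measurable_C.
- by move=> n z; have /andP[? ?] := f01 n z; rewrite ger0_norm.
- move=> z; apply: cvg_near_cst; case: (pselect (U z)) => Uz; last first.
    apply: nearW => n; rewrite /f_ dist1_in // mulr0 min_r ?ler01 // mulr0.
    by rewrite indicE memNset.
  have d0 : 0 < dist1 F z by apply: dist1_out => //; exact.
  near=> n; rewrite indicE mem_set // /f_ plateau_in; last first.
    by near: n; exact: nbhs_infty_ger.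
  rewrite min_l ?mulr1 // -ler_pdivrMr //.
  by near: n; exact: nbhs_infty_ger.
exists (f_ n); last by under eq_integral do rewrite distrC.
split => //; exists (n%:R + 1) => z hz.
by rewrite /f_ plateau_out // mul0r.
Unshelve. all: by end_near. Qed.

Let approximableC S : L1_approximable S -> L1_approximable (~` S).
Proof.
move=> [mS hS]; split; first exact: measurableC.
move=> e e0; have e20 : 0 < e / 2 by rewrite divr_gt0.
have [f tf hf] := hS _ e20.
have [_ /(_ _ e20)[g tg hg]] := approximable_open openT.
have [cf f01 _] := tf; have [cg g01 [r gr]] := tg.
have tgf : test_function (fun x => g x * (1 - f x)).
  split.
  - apply: continuous_mulR cg _; apply: continuous_subR cf.
    exact: cst_continuous.
  - move=> x; have /andP[? ?] := f01 x; have /andP[? ?] := g01 x.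
    by apply/andP; split; nra.
  - by exists r => z /gr ->; rewrite mul0r.
exists (fun x => g x * (1 - f x)) => //.
apply: L1_le hf hg.
- apply: mindic; exact: measurableC.
- exact: mtest.
- exact: mindic.
- exact: mtest.
- exact: mindic.
- exact: mtest.
move=> x; have -> : \1_(~` S) x = 1 - \1_S x :> R.
  by rewrite !indicE in_setC; case: (x \in S); rewrite ?subrr ?subr0.
have -> : \1_[set: C] x = 1 :> R by rewrite indicE mem_set.
have -> : 1 - \1_S x - g x * (1 - f x) =
  - (\1_S x - f x) + (1 - f x) * (1 - g x) by ring.
apply: le_trans (ler_normD _ _) _; rewrite normrN lerD2l normrM.
rewrite -[leRHS]mul1r ler_wpM2r //.
by have /andP[? ?] := f01 x; rewrite ger0_norm; lra.
Qed.

Let approximableI S1 S2 : L1_approximable S1 -> L1_approximable S2 ->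
  L1_approximable (S1 `&` S2).
Proof.
move=> [mS1 hS1] [mS2 hS2]; split; first exact: measurableI.
move=> e e0; have e20 : 0 < e / 2 by rewrite divr_gt0.
have [f tf hf] := hS1 _ e20; have [g tg hg] := hS2 _ e20.
have [cf f01 [r fr]] := tf; have [cg g01 _] := tg.
have tgf : test_function (fun x => f x * g x).
  split.
  - exact: continuous_mulR.
  - move=> x; have /andP[? ?] := f01 x; have /andP[? ?] := g01 x.
    by apply/andP; split; nra.
  - by exists r => z /fr ->; rewrite mul0r.
exists (fun x => f x * g x) => //.
apply: L1_le hf hg.
- apply: mindic; exact: measurableI.
- exact: mtest.
- exact: mindic.
- exact: mtest.
- exact: mindic.
- exact: mtest.
move=> x; rewrite indicI /=.
have -> : \1_S1 x * \1_S2 x - f x * g x =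
  (\1_S1 x - f x) * \1_S2 x + f x * (\1_S2 x - g x) by ring.
have /andP[? ?] := f01 x.
apply: le_trans (ler_normD _ _) _; rewrite !normrM; apply: lerD.
  rewrite -[leRHS]mulr1 ler_wpM2l // indicE.
  by case: (_ \in _); rewrite ?normr1 ?normr0.
by rewrite -[leRHS]mul1r ler_wpM2r // ger0_norm.
Qed.

Let approximable_bigcup (F : nat -> set C) : (forall n, L1_approximable (F n)) ->
  L1_approximable (\bigcup_n F n).
Proof.
move=> hF; pose G n := \big[setU/set0]_(i < n) F i.
have hG n : L1_approximable (G n).
  rewrite /G; elim: n => [|n IH].
    by rewrite big_ord0; apply: approximable_open; exact: open0.
  rewrite big_ord_recr /= -[_ `|` _]setCK setCU.
  by apply: approximableC; apply: approximableI; exact: approximableC.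
have mU : measurable (\bigcup_n F n).
  by apply: bigcupT_measurable => n; exact: (hF n).1.
split=> // e e0; have e20 : 0 < e / 2 by rewrite divr_gt0.
have [||||n hn] := @bounded_cvg_L1 (fun n => \1_(G n)) \1_(\bigcup_n F n) _ _ _ _ _ e20.
- by move=> n; apply: mindic; exact: (hG n).1.
- exact: mindic.
- by move=> n x; rewrite indicE; case: (_ \in _); rewrite ?normr1 ?normr0.
- move=> x; apply: cvg_near_cst.
  case: (pselect ((\bigcup_n F n) x)) => Ux; last first.
    apply: nearW => n; rewrite !indicE !memNset // => Gx; apply: Ux.
    by move: Gx; rewrite /G -bigcup_mkord => -[i _ Fx]; exists i.
  have [i _ Fx] := Ux; exists i.+1 => // n /= ni.
  rewrite !indicE !mem_set // /G -bigcup_mkord; exists i => //=.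
have [f tf hf] := (hG n).2 _ e20.
exists f => //; apply: L1_le hn hf.
- exact: mindic.
- exact: mtest.
- apply: mindic; exact: (hG n).1.
- exact: mindic.
- apply: mindic; exact: (hG n).1.
- exact: mtest.
move=> x; rewrite (distrC (\1_(G n) x)).
by apply: le_trans (ler_normD _ _); rewrite addrA subrK.
Qed.

(** The approximable sets form a sigma-algebra which contains the open sets. *)
Lemma L1_density S : measurable S -> forall e : R, 0 < e ->
  exists2 f, test_function f & (\int[nu]_x (`|\1_S x - f x|)%:E <= e%:E)%E.
Proof.
move=> mS; suff : L1_approximable S by case.
apply: (mS L1_approximable); split; last exact: approximable_open.
split.
- exact/approximable_open/open0.
- by move=> A hA; rewrite setTD; exact: approximableC.
- exact: approximable_bigcup.
Qed.

End Approximation.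

(** * Weak limits of counting measures *)

Section WeakLimits.
Variable R : realType.
Local Notation C := R[i].
Implicit Types (mu : {charge set C -> \bar R}) (f g : C -> R).

Let test_integral_fin (m : {measure set C -> \bar R}) f : (m setT < +oo)%E ->
  test_function f -> (\int[m]_z (f z)%:E)%E \is a fin_num.
Proof.
move=> mfin [cf f01 _]; rewrite ge0_fin_numE; last first.
  by apply: integral_ge0 => z _; rewrite lee_fin; case/andP: (f01 z).
apply: le_lt_trans mfin; rewrite -[m setT]mul1e -integral_cst //.
apply: ge0_le_integral => //.
- by move=> z _; rewrite lee_fin; case/andP: (f01 z).
- exact: continuous_measurable_EFin.
- by move=> z _; rewrite lee_fin; case/andP: (f01 z).
Qed.

(** A test function close in [L1] to the indicator of the negative Hahn set has an
integral close to minus the total mass of the negative part. *)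
Lemma charge_nonneg mu :
  (forall f, test_function f -> (0 <= charge_integral mu (fun z => (f z)%:E))%E) ->
  forall S, measurable S -> (0 <= mu S)%E.
Proof.
move=> h; have hahn := hahn_posnegP mu.
have [[mP _] [mN negN] PUN PIN] := hahn.
set mp := jordan_pos (hahn_posnegP mu).
set mn := jordan_neg (hahn_posnegP mu).
set N := hahn_neg mu.
have mpN : mp N = 0%E.
  rewrite /mp jordan_posE cjordan_posE /crestr0 mem_set // /crestr.
  by rewrite setIC PIN charge0.
have mpfin : (mp setT < +oo)%E by rewrite ltey_eq fin_num_measure.
have mnfin : (mn setT < +oo)%E by rewrite ltey_eq fin_num_measure.
have mnN : mn N = 0%E.
  apply/eqP; rewrite eq_le measure_ge0 andbT.
  apply/lee_addgt0Pr => e e0; rewrite add0e.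
  have nufin : (measure_add mp mn setT < +oo)%E.
    by rewrite measure_addE lte_add_pinfty.
  have [f tf hf] := L1_density nufin mN e0.
  have [cf f01 _] := tf.
  have mf : measurable_fun setT (EFin \o f).
    exact: continuous_measurable_EFin.
  have mi : measurable_fun setT (EFin \o (\1_N : C -> R)).
    exact/measurable_EFinP/measurable_indic.
  have mD : measurable_fun setT (fun x => (`|\1_N x - f x|)%:E).
    apply/measurable_EFinP; apply: measurableT_comp => //.
    by apply: measurable_funB; [exact: measurable_indic|exact: continuous_measurable_C].
  have f0 x : (0 <= (f x)%:E)%E by rewrite lee_fin; case/andP: (f01 x).
  have i0 x : (0 <= (\1_N x : R)%:E)%E by rewrite lee_fin.
  have D0 x : (0 <= (`|\1_N x - f x|)%:E)%E by rewrite lee_fin.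
  rewrite ge0_integral_measure_add // in hf.
  have h1 : (mn N <= \int[mn]_x (f x)%:E + \int[mn]_x (`|\1_N x - f x|)%:E)%E.
    have -> : mn N = (\int[mn]_x (\1_N x)%:E)%E by rewrite integral_indic // setIT.
    rewrite -ge0_integralD //.
    apply: ge0_le_integral => //.
    - exact: emeasurable_funD.
    - move=> x _; rewrite -EFinD lee_fin -lerBlDl; exact: ler_norm.
  have h2 : (\int[mp]_x (f x)%:E <= \int[mp]_x (`|\1_N x - f x|)%:E)%E.
    have e1 : mp N = (\int[mp]_x (\1_N x)%:E)%E by rewrite integral_indic // setIT.
    rewrite -[leRHS]add0e -mpN e1 -ge0_integralD //.
    apply: ge0_le_integral => //.
    - exact: emeasurable_funD.
    - move=> x _; rewrite -EFinD lee_fin -lerBlDl -normrN opprB; exact: ler_norm.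
  have h3 : (\int[mn]_x (f x)%:E <= \int[mp]_x (f x)%:E)%E.
    rewrite -sube_ge0; first exact: (h f tf).
    by apply/orP; left; exact: test_integral_fin.
  apply: le_trans h1 _; apply: le_trans hf; rewrite leeD2r //.
  exact: le_trans h3 h2.
move=> S mS; rewrite (jordan_decomp hahn mS) /cadd.
have mnS : mn S = 0%E.
  have -> : mn S = mn (S `&` N).
    rewrite /mn !jordan_negE !cjordan_negE /crestr0 !mem_set // ?/crestr.
      by rewrite -setIA setIid.
    exact: measurableI.
  apply/eqP; rewrite eq_le measure_ge0 andbT -mnN le_measure ?inE //.
  exact: measurableI.
rewrite -[X in (_ <= _ + X)%E]/((-1)%:E * mn S)%E mnS mule0 adde0.
exact: measure_ge0.
Qed.

Definition mean (s : seq C) f : R := (size s)%:R^-1 * \sum_(z <- s) f z.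

Lemma mean_ge0 s f : (forall z, 0 <= f z) -> 0 <= mean s f.
Proof. by move=> f0; rewrite mulr_ge0 ?invr_ge0 // sumr_ge0. Qed.

Lemma meanB s f g : mean s (fun z => f z - g z) = mean s f - mean s g.
Proof. by rewrite /mean sumrB mulrBr. Qed.

Lemma eq_mean s f g : {in s, f =1 g} -> mean s f = mean s g.
Proof. by move=> fg; rewrite /mean; congr (_ * _); exact: eq_big_seq. Qed.

Lemma mean_cst s c : (0 < size s)%N -> mean s (fun=> c) = c.
Proof.
move=> s0; rewrite /mean big_const_seq count_predT iter_addr_0 mulrnAr -mulrnAl.
by rewrite -[X in X * _]mulr_natl divff ?mul1r // pnatr_eq0 -lt0n.
Qed.

Lemma le_mean s f g : (forall z, z \in s -> f z <= g z) -> mean s f <= mean s g.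
Proof.
move=> fg; rewrite /mean ler_wpM2l ?invr_ge0 // big_seq [leRHS]big_seq.
exact: ler_sum.
Qed.

(** No mass escapes, because all configurations lie in one disc: a cut-off equal
to [1] there sees the whole mass, and functions which vanish there show that
there is no mass elsewhere. For the same reason the convergence extends from test
functions to all continuous functions. *)
Lemma weak_limit_probability (zs : nat -> seq C) mu (r : R) :
  (forall k, (0 < size (zs k))%N) ->
  (forall k z, z \in zs k -> normc z <= r) ->
  (forall f, test_function f -> (mean (zs k) f)%:E @[k --> \oo] -->
    charge_integral mu (fun z => (f z)%:E)) ->
  exists m : probability C R, [/\ forall S, measurable S -> mu S = m S,
    m [set z | r < normc z] = 0%E &
    forall f, continuous f ->
      mean (zs k) f @[k --> \oo] --> \int[m]_z f z].
Proof.
move=> zs0 zsr lim.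
have mu0 : forall S, measurable S -> (0 <= mu S)%E.
  apply: charge_nonneg => f tf.
  apply: (cvge_ge _ (lim f tf)); apply: nearW => k.
  rewrite lee_fin mean_ge0 // => z.
  by have [_ f01 _] := tf; case/andP: (f01 z).
pose m : {measure set C -> \bar R} := jordan_pos (hahn_posnegP mu).
have mum S : measurable S -> mu S = m S.
  by move=> mS; rewrite -jordan_pos_nonneg.
have {}lim f : test_function f ->
    (mean (zs k) f)%:E @[k --> \oo] --> (\int[m]_z (f z)%:E)%E.
  by move=> tf; rewrite -(charge_integral_nonneg mu0 _ mum); exact: lim.
have mfin : (m setT < +oo)%E by rewrite ltey_eq fin_num_measure.
have mo : measurable [set z : C | r < normc z].
  rewrite (_ : [set z | _] = ~` [set z | normc (z - 0) <= r]).
    by apply: measurableC; apply: closed_measurable_C; exact: closed_disc.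
  by apply/seteqP; split=> z /=; rewrite subr0 ltNge => /negP.
have out : m [set z | r < normc z] = 0%E.
  pose g j z := plateau j%:R z * Num.min 1 (Num.max (normc z - r) 0).
  have mm z : 0 <= Num.min 1 (Num.max (normc z - r) 0) <= 1.
    by rewrite le_min ler01 le_max lexx orbT /= ge_min lexx.
  have g01 j z : 0 <= g j z <= 1.
    have /andP[? ?] := mm z.
    by rewrite mulr_ge0 ?plateau_ge0 //= mulr_ile1 ?plateau_ge0 ?plateau_le1.
  have cg j : continuous (g j).
    apply: continuous_mulR; first exact: continuous_plateau.
    apply: (@lipschitz_continuous_R _ _ 1) => x y; rewrite mul1r.
    apply: le_trans (lipschitz_minr _ _ _) _; apply: le_trans (lipschitz_maxr _ _ _) _.
    by rewrite opprB addrA subrK lipschitz_normc.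
  have tg j : test_function (g j).
    split=> //; exists (j%:R + 1) => z hz.
    by rewrite /g plateau_out // mul0r.
  have mg j : measurable_fun setT (EFin \o g j).
    exact: continuous_measurable_EFin.
  have gnull j : m.-negligible [set z | g j z != 0].
    have int0 : (\int[m]_z `|(g j z)%:E| = 0)%E.
      rewrite (_ : (fun z => _) = (fun z => (g j z)%:E)); last first.
        by apply/funext => z; rewrite gee0_abs // lee_fin; case/andP: (g01 j z).
      apply: (cvg_unique (@ereal_hausdorff R) (lim _ (tg j))).
      apply: cvg_near_cst; apply: nearW => k.
      suff -> : mean (zs k) (g j) = 0 by [].
      rewrite (@eq_mean _ _ (fun=> 0)) ?mean_cst //.
      by move=> z /zsr zr; rewrite /g max_r ?subr_le0 // min_r // mulr0.
    have /ae_eq_integral_abs := int0; move=> /(_ measurableT (mg j)) [A [mA A0 hA]].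
    exists A; split=> // z /= gz; apply: hA => /(_ I) /= [] gz0.
    by rewrite gz0 eqxx in gz.
  apply/negligibleP => //.
  apply: (negligibleS _ (negligible_bigcup gnull)) => z /= rz.
  exists (Num.bound (normc z)) => //=; rewrite /g plateau_in.
    by rewrite mul1r gt_eqF // lt_min ltr01 lt_max subr_gt0 rz.
  by apply/ltW/archi_boundP/normc_ge0.
have aer (f g : C -> \bar R) : (forall z, normc z <= r -> f z = g z) ->
    ae_eq m setT f g.
  move=> fg; exists [set z | r < normc z]; split=> // z /=.
  by rewrite ltNge => h; apply/negP => /fg e; apply: h => _.
have testT : test_function (plateau r).
  split; first exact: continuous_plateau.
    by move=> z; rewrite plateau_ge0 plateau_le1.
  by exists (r + 1) => z; exact: plateau_out.
have mT : m setT = 1%E.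
  have e : (\int[m]_z (plateau r z)%:E)%E = 1%E.
    apply: (cvg_unique (@ereal_hausdorff R) (lim _ testT)).
    apply: cvg_near_cst; apply: nearW => k.
    suff -> : mean (zs k) (plateau r) = 1 by [].
    rewrite (@eq_mean _ _ (fun=> 1)) ?mean_cst //.
    by move=> z /zsr; exact: plateau_in.
  rewrite -e -[LHS]mul1e -integral_cst //; apply: ae_eq_integral => //.
    by apply: continuous_measurable_EFin; case: testT.
  by apply: aer => z /plateau_in ->.
pose mP := Measure_isProbability.Build _ _ _ m mT.
pose P : probability C R := HB.pack (Measure.sort m) mP.
exists P; split=> // f cf.
have [M M0 fM] := continuous_bounded_disc (r + 1) cf.
(* An affine function of f with values in [0, 1] on the support of the cut-off. *)
pose g z := plateau r z * ((f z + M) / (2 * M)).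
have M2 : 0 < 2 * M by rewrite mulr_gt0.
have cg : continuous g.
  apply: continuous_mulR; first exact: continuous_plateau.
  apply: continuous_mulR; last exact: cst_continuous.
  rewrite (_ : (fun x => _) = (fun x => f x - (- M))).
    by apply: continuous_subR => //; exact: cst_continuous.
  by apply/funext => x; rewrite opprK.
have tg : test_function g.
  split=> //; last by exists (r + 1) => z hz; rewrite /g plateau_out // mul0r.
  move=> z; have [hz|hz] := leP (normc z) (r + 1); last first.
    by rewrite /g plateau_out // mul0r lexx ler01.
  have := fM z hz; rewrite ler_norml => /andP[h1 h2].
  have q0 : 0 <= (f z + M) / (2 * M) by rewrite divr_ge0 ?(ltW M2) //; lra.
  have q1 : (f z + M) / (2 * M) <= 1 by rewrite ler_pdivrMr //; lra.
  by rewrite /g mulr_ge0 ?plateau_ge0 //= mulr_ile1 ?plateau_ge0 ?plateau_le1.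
have fg z : normc z <= r -> f z = 2 * M * g z - M.
  by move=> zr; rewrite /g plateau_in //; field; rewrite gt_eqF.
have gi : m.-integrable setT (EFin \o g).
  apply/integrableP; split; first exact: continuous_measurable_EFin.
  under eq_integral => z _.
    rewrite gee0_abs ?lee_fin; last by have [_ g01 _] := tg; case/andP: (g01 z).
    over.
  by rewrite ltey_eq test_integral_fin.
have -> : \int[P]_z f z = 2 * M * \int[m]_z g z - M.
  have -> : \int[P]_z f z = \int[m]_z (2 * M * g z - M).
    rewrite /Rintegral; congr fine; apply: ae_eq_integral => //.
    - exact: continuous_measurable_EFin.
    - apply: continuous_measurable_EFin.
      apply: continuous_subR; last exact: cst_continuous.
      by apply: continuous_mulR => //; exact: cst_continuous.
    - by apply: aer => z /fg ->.
  have ic : m.-integrable setT (EFin \o (cst M : C -> R)).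
    exact: (finite_measure_integrable_cst P).
  rewrite RintegralB //; last first.
    rewrite (_ : EFin \o _ = (fun z => (2 * M)%:E * (g z)%:E)%E) //.
    exact: integrableZl.
  rewrite RintegralZl //; congr (_ - _).
  by rewrite /Rintegral integral_cst //= mT mule1.
have -> : (fun k => mean (zs k) f) = (fun k => 2 * M * mean (zs k) g - M).
  apply/funext => k; rewrite (@eq_mean _ _ (fun z => 2 * M * g z - M)).
    rewrite meanB mean_cst //; congr (_ - _).
    by rewrite /mean -mulr_sumr mulrCA.
  by move=> z /zsr; exact: fg.
apply: cvgB; last exact: cvg_cst.
apply: cvgMr.
by have := lim _ tg; rewrite -(fineK (test_integral_fin mfin tg)) => /fine_cvgP[].
Qed.

End WeakLimits.

(** * Weak limits of product measures *)

Section Bounded.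
Context d (T : measurableType d) (R : realType) (P : probability T R).
Implicit Types f g : T -> R.

Lemma bounded_integrable f b : measurable_fun setT f -> (forall x, `|f x| <= b) ->
  P.-integrable setT (EFin \o f).
Proof.
move=> mf fb; apply: (le_integrable _ _ _ (finite_measure_integrable_cst P b measurableT)) => //.
  exact/measurable_EFinP.
by move=> x _ /=; rewrite lee_fin (le_trans (fb x)) // ler_norm.
Qed.

Lemma Rintegral_cstP c : \int[P]_x (cst c x) = c.
Proof. by rewrite Rintegral_cst //= probability_setT mulr1. Qed.

Lemma norm_Rintegral_le f b : measurable_fun setT f -> (forall x, `|f x| <= b) ->
  `|\int[P]_x f x| <= b.
Proof.
move=> mf fb; apply: le_trans (le_normr_Rintegral _ _) _ => //.
  exact: bounded_integrable fb.
rewrite -[leRHS]Rintegral_cstP; apply: le_Rintegral => //.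
- apply: (@bounded_integrable _ b); first exact: measurableT_comp.
  by move=> x; rewrite normr_id.
- exact: finite_measure_integrable_cst.
Qed.

Lemma norm_RintegralB_le f g bf bg b : measurable_fun setT f -> measurable_fun setT g ->
  (forall x, `|f x| <= bf) -> (forall x, `|g x| <= bg) ->
  (forall x, `|f x - g x| <= b) ->
  `|\int[P]_x f x - \int[P]_x g x| <= b.
Proof.
move=> mf mg hf hg h; rewrite -RintegralB //.
- by apply: norm_Rintegral_le => //; exact: measurable_funB.
- exact: bounded_integrable hf.
- exact: bounded_integrable hg.
Qed.

End Bounded.

Section DoubleMean.
Variable R : realType.
Local Notation C := R[i].
Variables (zs : nat -> seq C) (m : probability C R) (r0 : R).
Hypothesis zs_disc : forall k z, z \in zs k -> normc z <= r0.
Hypothesis zs_gt0 : forall k, (0 < size (zs k))%N.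
Hypothesis zs_lim : forall f : C -> R, continuous f ->
  mean (zs k) f @[k --> \oo] --> \int[m]_z f z.

Lemma finite_net r e : 0 < e -> exists s : seq C, forall z, normc z <= r ->
  exists2 w, w \in s & normc (z - w) < e.
Proof.
move=> e0; have : compact [set w : C | normc w <= r] by exact: compact_disc.
rewrite compact_cover => /(_ C setT (fun w => [set z | normc (z - w) < e])).
case=> [w _|z _|D _ hD]; first exact: open_disc.
  by exists z => //=; rewrite subrr normc0.
exists (finmap.enum_fset D) => z /hD [w wD /=] zw.
by exists w.
Qed.

Lemma norm_mean_le s (f : C -> R) b : (0 < size s)%N ->
  (forall z, z \in s -> `|f z| <= b) -> `|mean s f| <= b.
Proof.
move=> s0 h; rewrite ler_norml -{1}(mean_cst (- b) s0) -{2}(mean_cst b s0).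
by apply/andP; split; apply: le_mean => z /h; rewrite ler_norml => /andP[].
Qed.

Lemma near_all_seq (s : seq C) (Q : C -> nat -> Prop) :
  (forall w, \forall k \near \oo, Q w k) ->
  \forall k \near \oo, forall w, w \in s -> Q w k.
Proof.
move=> h; elim: s => [|w s IH]; first exact: nearW.
apply: filterS2 (h w) IH => k h1 h2 v; rewrite inE => /orP[/eqP->|/h2] //.
Qed.

(** Weak convergence of the product measures. The partial means of [F] are
uniformly Lipschitz, so that they converge uniformly on the disc, and not only
pointwise. *)
Lemma double_mean_cvg (F : C -> C -> R) L b : 0 <= L ->
  (forall x y, `|F x y| <= b) ->
  (forall x x' y, `|F x y - F x' y| <= L * normc (x - x')) ->
  (forall x y y', `|F x y - F x y'| <= L * normc (y - y')) ->
  mean (zs k) (fun x => mean (zs k) (F x)) @[k --> \oo] -->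
    \int[m]_x (\int[m]_y F x y).
Proof.
move=> L0 Fb F1 F2; pose G x := \int[m]_y F x y.
have cF x : continuous (F x) by apply: (@lipschitz_continuous_R _ _ L); exact: F2.
have mF x : measurable_fun setT (F x) by exact: continuous_measurable_C.
have GL x x' : `|G x - G x'| <= L * normc (x - x').
  by apply: (@norm_RintegralB_le _ _ _ m _ _ b b) => // y; exact: F1.
have cG : continuous G by exact: lipschitz_continuous_R GL.
have limG := zs_lim cG.
apply/cvgrPdist_le => e e0.
have e4 : 0 < e / 4 by rewrite divr_gt0.
have d0 : 0 < e / 4 / (L + 1) by rewrite divr_gt0 // ltr_wpDl.
have [s hs] := finite_net r0 d0.
have near1 : \forall k \near \oo, forall w, w \in s ->
    `|mean (zs k) (F w) - G w| <= e / 4.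
  apply: near_all_seq => w.
  have /cvgrPdist_le /(_ _ e4) := zs_lim (cF w).
  by apply: filterS => k; rewrite distrC.
have near2 : \forall k \near \oo, `|\int[m]_x G x - mean (zs k) G| <= e / 4.
  by have /cvgrPdist_le := limG; apply.
apply: filterS2 near1 near2 => k h1 h2.
have h3 : `|mean (zs k) G - mean (zs k) (fun x => mean (zs k) (F x))| <= 3 * (e / 4).
  rewrite -meanB; apply: norm_mean_le => // z /zs_disc /hs [w ws zw].
  have zwL : L * normc (z - w) <= e / 4.
    move: zw; rewrite ltr_pdivlMr ?ltr_wpDl // => /ltW; apply: le_trans.
    by rewrite mulrC ler_wpM2l ?normc_ge0 // lerDl.
  have -> : G z - mean (zs k) (F z) = (G z - G w) + (G w - mean (zs k) (F w))
    + mean (zs k) (fun y => F w y - F z y) by rewrite meanB; ring.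
  apply: le_trans (ler_normD _ _) _.
  have : `|mean (zs k) (fun y => F w y - F z y)| <= e / 4.
    apply: norm_mean_le => // y _; rewrite distrC.
    exact: le_trans (F1 _ _ _) zwL.
  have := ler_normD (G z - G w) (G w - mean (zs k) (F w)).
  have := le_trans (GL z w) zwL; have := h1 w ws; rewrite (distrC (mean _ _)).
  lra.
have -> : \int[m]_x G x - mean (zs k) (fun x => mean (zs k) (F x)) =
  (\int[m]_x G x - mean (zs k) G) +
  (mean (zs k) G - mean (zs k) (fun x => mean (zs k) (F x))) by ring.
apply: le_trans (ler_normD _ _) _; lra.
Qed.

End DoubleMean.

(** * Kernels near the diagonal *)

Section NearDiagonal.
Variable R : realType.
Local Notation C := R[i].

Lemma measurable_normcB2 :
  measurable_fun setT (fun q : C * C => normc (q.1 - q.2)).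
Proof. exact: measurable_normcB measurable_fst measurable_snd. Qed.

Definition near_diagonal (r : R) : set (C * C) :=
  [set q | normc (q.1 - q.2) <= r].

Lemma measurable_near_diagonal r : measurable (near_diagonal r).
Proof.
have := measurable_normcB2 measurableT (measurable_itv `]-oo, r]).
by rewrite setTI.
Qed.

End NearDiagonal.

Section RegularizedKernel.
Variable R : realType.
Local Notation C := R[i].
Local Notation Re := (@complex.Re R).
Local Notation Im := (@complex.Im R).
Implicit Types (h : C -> C) (x y u v w : C).

Definition dotc w u : R := Re w * Re u + Im w * Im u.

Lemma norm_dotc w u : `|dotc w u| <= normc w * normc u.
Proof.
rewrite ler_norml ReIm_le_normc andbT lerNl.
have := ReIm_le_normc (- w) u; rewrite normcN ReN ImN.
by rewrite !mulNr -opprD.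
Qed.

Lemma dotcBl w w' u : dotc (w - w') u = dotc w u - dotc w' u.
Proof. by rewrite /dotc ReB ImB; ring. Qed.

Lemma dotcBr w u v : dotc w (u - v) = dotc w u - dotc w v.
Proof. by rewrite /dotc !ReB !ImB; ring. Qed.

Lemma variation_kernelE h x y :
  variation_kernel h x y = dotc (h x - h y) (x - y) / normc (x - y) ^+ 2.
Proof. exact: Re_div. Qed.

(** [variation_kernel h] is bounded for a Lipschitz [h], but in general it is not
continuous on the diagonal. This kernel is continuous and differs from it only
near the diagonal. *)
Definition regular_kernel (d : R) h x y : R :=
  dotc (h x - h y) (x - y) / Num.max (normc (x - y)) d ^+ 2.

Lemma norm_regular_kernel d h L x y : 0 < d -> 0 <= L -> lipschitzc L h ->
  `|regular_kernel d h x y| <= L.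
Proof.
move=> d0 L0 hL.
have M0 : 0 < Num.max (normc (x - y)) d by rewrite lt_max d0 orbT.
rewrite normrM normfV (ger0_norm (_ : 0 <= _ ^+ 2)) ?exprn_ge0 ?(ltW M0) //.
rewrite ler_pdivrMr ?exprn_gt0 //; apply: le_trans (norm_dotc _ _) _.
apply: (@le_trans _ _ (L * normc (x - y) * normc (x - y))).
  by rewrite ler_wpM2r ?normc_ge0.
rewrite -mulrA ler_wpM2l // expr2 ler_pM ?normc_ge0 // le_max lexx //.
Qed.

Lemma regular_kernel_close d h L x y : 0 < d -> 0 <= L -> lipschitzc L h ->
  `|regular_kernel d h x y - variation_kernel h x y| <=
  L * (normc (x - y) <= d)%R%:R.
Proof.
move=> d0 L0 hL; have [xyd|xyd] := leP (normc (x - y)) d; last first.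
  rewrite /regular_kernel variation_kernelE max_l; last exact: ltW.
  by rewrite subrr normr0 mulr0.
rewrite mulr1; have := norm_variation_kernel x y L0 hL.
have [->|xy] := eqVneq x y.
  by rewrite /regular_kernel variation_kernelE !subrr /dotc /= !mul0r addr0 !mul0r subrr normr0.
have u0 : 0 < normc (x - y) by rewrite normc_gt0 subr_eq0.
have -> : regular_kernel d h x y =
    variation_kernel h x y * (normc (x - y) / d) ^+ 2.
  rewrite /regular_kernel variation_kernelE max_r //; field.
  by rewrite !gt_eqF.
set t := (_ / _) ^+ 2; set k := variation_kernel h x y => kL.
have t0 : 0 <= t by rewrite exprn_ge0 // divr_ge0 ?normc_ge0 // ltW.
have t1 : t <= 1.
  by rewrite exprn_ile1 ?divr_ge0 ?normc_ge0 ?(ltW d0) // ler_pdivrMr // mul1r.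
have -> : k * t - k = k * (t - 1) by ring.
rewrite normrM -[leRHS]mulr1 ler_pM // ler_norml; apply/andP; split; lra.
Qed.

(** The kernel is the real inner product of [h x - h y] with a bounded Lipschitz
function of [x - y]. *)
Lemma lipschitz_regular_kernel d h L b : 0 < d -> 0 <= L -> lipschitzc L h ->
  (forall x, normc (h x) <= b) ->
  forall x x' y, `|regular_kernel d h x y - regular_kernel d h x' y| <=
    (L / d + 6 * b / d ^+ 2) * normc (x - x').
Proof.
move=> d0 L0 hL hb x x' y.
pose q u := (Num.max (normc u) d)^-1.
pose rho u : C := (q u)%:C * huber d u.
have M0 u : 0 < Num.max (normc u) d by rewrite lt_max d0 orbT.
have q0 u : 0 <= q u by rewrite invr_ge0 ltW.
have qd u : q u <= d^-1 by rewrite lef_pV2 ?posrE // le_max lexx orbT.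
have di0 : 0 <= d^-1 by rewrite invr_ge0 ltW.
have kE z : regular_kernel d h z y = dotc (h z - h y) (rho (z - y)).
  rewrite /regular_kernel /dotc /rho /huber -/(q _) !Re_rM !Im_rM.
  by rewrite /q; field; rewrite gt_eqF.
have rho1 u : normc (rho u) <= d^-1.
  rewrite normc_rM ger0_norm // -[leRHS]mulr1 ler_pM ?normc_ge0 //.
  exact: normc_huber.
have rho2 u v : normc (rho u - rho v) <= 3 / d ^+ 2 * normc (u - v).
  have -> : rho u - rho v =
      (q u)%:C * (huber d u - huber d v) + (q u - q v)%:C * huber d v.
    by rewrite /rho rmorphB /=; ring.
  apply: le_trans (le_normcD _ _) _; rewrite (normc_rM (q u)) (normc_rM (q u - q v)) ger0_norm //.
  have h1 : q u * normc (huber d u - huber d v) <=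
      d^-1 * (2 / d * normc (u - v)).
    by rewrite ler_pM ?normc_ge0 //; exact: lipschitz_huber.
  have h2 : `|q u - q v| * normc (huber d v) <=
      d^-1 ^+ 2 * normc (u - v) * 1.
    rewrite ler_pM ?normc_ge0 ?normc_huber //.
    apply: le_trans (lipschitz_inv_maxr _ _ d0) _.
    by rewrite ler_wpM2l ?exprn_ge0 // lipschitz_normc.
  have -> : 3 / d ^+ 2 * normc (u - v) =
    d^-1 * (2 / d * normc (u - v)) + d^-1 ^+ 2 * normc (u - v) * 1.
    by field; rewrite gt_eqF.
  exact: lerD.
rewrite !kE.
have -> : dotc (h x - h y) (rho (x - y)) - dotc (h x' - h y) (rho (x' - y)) =
    dotc (h x - h x') (rho (x - y)) +
    dotc (h x' - h y) (rho (x - y) - rho (x' - y)).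
  rewrite dotcBr; have -> : h x - h x' = (h x - h y) - (h x' - h y) by ring.
  by rewrite [dotc (_ - (h x' - h y)) _]dotcBl; ring.
apply: le_trans (ler_normD _ _) _; rewrite mulrDl; apply: lerD.
  apply: le_trans (norm_dotc _ _) _; rewrite mulrAC.
  by apply: ler_pM; rewrite ?normc_ge0.
apply: le_trans (norm_dotc _ _) _.
have -> : 6 * b / d ^+ 2 * normc (x - x') =
  (2 * b) * (3 / d ^+ 2 * normc (x - x')) by field; rewrite gt_eqF.
apply: ler_pM; rewrite ?normc_ge0 //.
  apply: le_trans (le_normcB _ _) _; have := hb x'; have := hb y; lra.
by apply: le_trans (rho2 _ _) _; rewrite opprB addrA subrK.
Qed.

Lemma regular_kernelC d h x y : regular_kernel d h x y = regular_kernel d h y x.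
Proof.
rewrite /regular_kernel /dotc (normcBC x y); congr (_ / _).
by rewrite !ReB !ImB; ring.
Qed.

(** The absolute value makes the inverse a real power. *)
Lemma measurable_invr : measurable_fun [set: R] (fun t : R => (`|t|)^-1).
Proof.
rewrite (_ : (fun t => _) = (fun t => (`|t|) `^ (-1))); last first.
  by apply/funext => t; rewrite powR_inv1.
apply: (measurableT_comp (@measurable_powR _ (-1))) => //.
Qed.

Section measurability.
Context dsp (T : measurableType dsp).
Variables (h : C -> C) (f g : T -> C).
Hypotheses (ch : continuous h).
Hypotheses (mf : measurable_fun setT f) (mg : measurable_fun setT g).

Let mhf : measurable_fun setT (h \o f).
Proof. exact: measurableT_comp (continuous_measurable_CC ch) mf. Qed.

Let mhg : measurable_fun setT (h \o g).
Proof. exact: measurableT_comp (continuous_measurable_CC ch) mg. Qed.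

Let mdot : measurable_fun setT (fun t => dotc (h (f t) - h (g t)) (f t - g t)).
Proof.
rewrite /dotc; under eq_fun do rewrite !ReB !ImB.
apply: measurable_funD; apply: measurable_funM; apply: measurable_funB;
  do ?[exact: measurable_Re | exact: measurable_Im].
Qed.

Lemma measurable_variation_kernel :
  measurable_fun setT (fun t => variation_kernel h (f t) (g t)).
Proof.
under eq_fun do rewrite variation_kernelE -(ger0_norm (sqr_ge0 (normc _))).
apply: measurable_funM; first exact: mdot.
apply: (measurableT_comp measurable_invr); exact: measurable_sqr_normcB.
Qed.

Lemma measurable_regular_kernel d :
  measurable_fun setT (fun t => regular_kernel d h (f t) (g t)).
Proof.
under eq_fun do rewrite /regular_kernel -(ger0_norm (sqr_ge0 (Num.max _ _))).
apply: measurable_funM; first exact: mdot.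
apply: (measurableT_comp measurable_invr); apply: measurable_funX.
by apply: measurable_maxr; [exact: measurable_normcB | exact: measurable_cst].
Qed.

End measurability.
End RegularizedKernel.

(** * Smooth functions are Lipschitz on discs *)

Section SmoothLipschitz.
Variable R : realType.
Local Notation C := R[i].
Local Notation Re := (@complex.Re R).
Local Notation Im := (@complex.Im R).
Implicit Types (u : R * R -> R) (r s c : R).

Lemma is_derive_partial1 u s c : derivable u (s, c) (1, 0) ->
  is_derive s 1 (fun x => u (x, c)) ('D_(1, 0) u (s, c)).
Proof.
have E : (fun h : R => h^-1 *: (((fun x => u (x, c)) \o shift s) (h *: (1 : R))
    - u (s, c))) =
  (fun h : R => h^-1 *: ((u \o shift (s, c)) (h *: ((1, 0) : R * R)) - u (s, c))).
  apply/funext => h /=; congr (_ *: (u _ - _)).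
  by rewrite /shift /=; congr (_, _); rewrite /= scaler0 add0r.
by move=> du; split; rewrite /derivable /derive /= E.
Qed.

Lemma is_derive_partial2 u s c : derivable u (s, c) (0, 1) ->
  is_derive c 1 (fun x => u (s, x)) ('D_(0, 1) u (s, c)).
Proof.
have E : (fun h : R => h^-1 *: (((fun x => u (s, x)) \o shift c) (h *: (1 : R))
    - u (s, c))) =
  (fun h : R => h^-1 *: ((u \o shift (s, c)) (h *: ((0, 1) : R * R)) - u (s, c))).
  apply/funext => h /=; congr (_ *: (u _ - _)).
  by rewrite /shift /=; congr (_, _); rewrite /= scaler0 add0r.
by move=> du; split; rewrite /derivable /derive /= E.
Qed.

Lemma continuous_bounded_square u r : continuous u ->
  exists2 M, 0 <= M & forall x y, - r <= x <= r -> - r <= y <= r -> `|u (x, y)| <= M.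
Proof.
move=> cu; pose K : set (R * R) := `[- r, r]%classic `*` `[- r, r]%classic.
have cK : compact K by apply: compact_setX; exact: segment_compact.
have cuK : compact (u @` K).
  by apply: continuous_compact => //; exact: continuous_subspaceT.
have [M [_ hM]] := compact_bounded cuK.
exists (Num.max M 0 + 1); first by rewrite addr_ge0 // le_max lexx orbT.
move=> x y xr yr; apply: hM; first by rewrite ltr_pwDr // le_max lexx.
by exists (x, y) => //; split; rewrite /= in_itv.
Qed.

Lemma mean_value_bound (f f' : R -> R) r (M : R) :
  (forall x : R, is_derive x 1 f (f' x)) ->
  (forall x, - r <= x <= r -> `|f' x| <= M) ->
  forall x y, - r <= x <= r -> - r <= y <= r -> `|f x - f y| <= M * `|x - y|.
Proof.
move=> df hM.
have key x y : - r <= x <= r -> - r <= y <= r -> x <= y ->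
    `|f x - f y| <= M * `|x - y|.
  move=> /andP[rx xr] /andP[ry yr] xy.
  case: (@MVT_segment R f f' x y xy) => [|c /[!in_itv] /= /andP[xc cy] e].
  - apply: derivable_within_continuous => z _.
    by have [] := df z.
  rewrite distrC e (distrC x) normrM ler_wpM2r // hM //.
  by rewrite (le_trans rx xc) (le_trans cy yr).
move=> x y hx hy; have [xy|yx] := leP x y; first exact: key.
by rewrite distrC (distrC x); apply: key => //; exact: ltW.
Qed.

Lemma C1_lipschitz_square u r : Ck 1 u ->
  exists2 L, 0 <= L & forall x1 y1 x2 y2,
   - r <= x1 <= r -> - r <= y1 <= r -> - r <= x2 <= r -> - r <= y2 <= r ->
   `|u (x1, y1) - u (x2, y2)| <= L * (`|x1 - x2| + `|y1 - y2|).
Proof.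
move=> [d1 d2 c1 c2].
have [M1 M10 h1] := continuous_bounded_square r c1.
have [M2 M20 h2] := continuous_bounded_square r c2.
exists (M1 + M2); first exact: addr_ge0.
move=> x1 y1 x2 y2 hx1 hy1 hx2 hy2.
have e1 : `|u (x1, y1) - u (x2, y1)| <= M1 * `|x1 - x2|.
  apply: (@mean_value_bound (fun x => u (x, y1)) (fun x => 'D_(1, 0) u (x, y1)) r) => //.
    by move=> x; apply: is_derive_partial1; exact: d1.
  by move=> x hx; exact: h1.
have e2 : `|u (x2, y1) - u (x2, y2)| <= M2 * `|y1 - y2|.
  apply: (@mean_value_bound (fun y => u (x2, y)) (fun y => 'D_(0, 1) u (x2, y)) r) => //.
    by move=> y; apply: is_derive_partial2; exact: d2.
  by move=> y hy; exact: h2.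
have := ler_normD (u (x1, y1) - u (x2, y1)) (u (x2, y1) - u (x2, y2)).
rewrite addrA subrK => h.
have := mulr_ge0 M10 (normr_ge0 (y1 - y2)); have := mulr_ge0 M20 (normr_ge0 (x1 - x2)).
lra.
Qed.

Lemma smooth_lipschitz_disc (h : C -> C) r : smooth h ->
  exists2 L, 0 <= L & forall x y, normc x <= r -> normc y <= r ->
    normc (h x - h y) <= L * normc (x - y).
Proof.
move=> [_ /(_ 1%N)[/(@C1_lipschitz_square _ r)[L1 L10 h1]
  /(@C1_lipschitz_square _ r)[L2 L20 h2]]].
exists ((L1 + L2) * 2); first by rewrite mulr_ge0 // addr_ge0.
have box z : normc z <= r -> (- r <= Re z <= r) * (- r <= Im z <= r).
  by move=> zr; rewrite -!ler_norml; split; apply: le_trans zr;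
    [exact: normc_Re | exact: normc_Im].
move=> x y /box[bx1 bx2] /box[by1 by2].
apply: le_trans (normc_le_ReIm _) _; rewrite ReB ImB.
have := h1 _ _ _ _ bx1 bx2 by1 by2; have := h2 _ _ _ _ bx1 bx2 by1 by2.
have -> : (Re x, Im x).1 +i* (Re x, Im x).2 = x by case: (x).
have -> : (Re y, Im y).1 +i* (Re y, Im y).2 = y by case: (y).
set D := `|Re x - Re y| + `|Im x - Im y|.
have hD : D <= 2 * normc (x - y).
  have := normc_Re (x - y); have := normc_Im (x - y); rewrite ReB ImB /D; lra.
have h3 : (L1 + L2) * D <= (L1 + L2) * (2 * normc (x - y)).
  by rewrite ler_wpM2l // addr_ge0.
lra.
Qed.

End SmoothLipschitz.

(** * The logarithmic kernel *)

Section LogKernel.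
Variable R : realType.
Local Notation C := R[i].
Implicit Types (x y z : C).

Lemma log_kernel_fin x y : x != y ->
  log_kernel x y = (- ln (normc (x - y)))%:E.
Proof.
by move=> xy; rewrite /log_kernel lne_EFin // normc_gt0 subr_eq0.
Qed.

Lemma measurable_log_kernel dsp (T : measurableType dsp) (f g : T -> C) :
  measurable_fun setT f -> measurable_fun setT g ->
  measurable_fun setT (fun t => log_kernel (f t) (g t)).
Proof.
move=> mf mg; rewrite /log_kernel /lne.
have mn : measurable_fun setT (fun t => normc (f t - g t)) by exact: measurable_normcB.
apply: measurableT_comp => //; apply: measurable_fun_ifT.
- by apply: measurable_fun_ler => //; exact: measurable_cst.
- exact: measurable_cst.
- by apply/measurable_EFinP; apply: measurableT_comp => //; exact: measurable_ln.
Qed.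

(** The number of powers of [1 / 4] which are at least [s] is at least the logarithm of
[1 / s] to the base [4]. The logarithmic singularity is thus dominated by a sum of
indicators of discs. *)
Lemma ln_inv_le N (s : R) : 0 < s -> (4 ^+ N)^-1 <= s ->
  - ln s <= ln 4 * \sum_(k < N) (s <= (4 ^+ k)^-1)%R%:R.
Proof.
move=> s0; have l4 : 0 <= ln 4 :> R by rewrite ln_ge0 // ler1n.
elim: N => [|N IH] hs.
  by rewrite big_ord0 mulr0 oppr_le0 ln_ge0 // -invr1 -[1%R](expr0 4).
have [h|h] := leP (4 ^+ N)^-1 s.
  apply: le_trans (IH h) _; rewrite big_ord_recr /= mulrDr lerDl.
  by rewrite mulr_ge0.
have -> : \sum_(k < N.+1) (s <= (4 ^+ k)^-1)%R%:R = N.+1%:R :> R.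
  rewrite (eq_bigr (fun=> 1)) ?sumr_const ?card_ord // => k _.
  suff -> : (s <= (4 ^+ k)^-1)%R by [].
  apply: le_trans (ltW h) _; rewrite lef_pV2 ?posrE ?exprn_gt0 //.
  by rewrite ler_weXn2l ?ler1n // -ltnS.
rewrite -lnV ?posrE // mulr_natr -lnXn // ler_ln ?posrE ?invr_gt0 ?exprn_gt0 //.
by rewrite -[leRHS]invrK lef_pV2 ?posrE ?invr_gt0 ?exprn_gt0.
Qed.

Lemma small_power (s : R) : 0 < s -> exists N : nat, (4 ^+ N)^-1 <= s.
Proof.
move=> s0; exists (Num.bound s^-1).
rewrite -[s in leRHS]invrK lef_pV2 ?posrE ?invr_gt0 ?exprn_gt0 //.
apply: (@le_trans _ _ (Num.bound s^-1)%:R).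
  by apply/ltW/archi_boundP; rewrite invr_ge0 ltW.
rewrite -natrX ler_nat; apply: ltnW; exact: ltn_expl.
Qed.

(** Write [normc (1 + k) ^+ 2 = 1 + S] with [S = 2 Re k + normc k ^+ 2]; then
[S - 2 S ^+ 2 <= ln (1 + S) <= S], and the absolute value of [S]
is at most [3 e]. *)
Lemma ln_norm_expansion (k : C) (e : R) : 0 <= e -> e <= 8^-1 -> normc k <= e ->
  `|ln (normc (1 + k)) - complex.Re k| <= 10 * e ^+ 2.
Proof.
move=> e0 e8 ke.
have k0 := normc_ge0 k.
have n1 : 0 < normc (1 + k).
  have := le_normcD (1 + k) (- k); rewrite addrK normc1 normcN; lra.
pose S := 2 * complex.Re k + normc k ^+ 2.
have SE : normc (1 + k) ^+ 2 = 1 + S.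
  by rewrite /S !sqr_normc ReD ImD /=; ring.
have hk : `|complex.Re k| <= e by apply: le_trans (normc_Re k) ke.
have k2 : normc k ^+ 2 <= e ^+ 2 by rewrite ler_pXn2r ?nnegrE.
have e2 : e ^+ 2 <= 8^-1 * e by rewrite expr2 ler_wpM2r.
have k20 : 0 <= normc k ^+ 2 by exact: exprn_ge0.
move: (hk); rewrite ler_norml => /andP[hk1 hk2].
have S3 : `|S| <= 3 * e by rewrite ler_norml /S; apply/andP; split; lra.
have S1 : - 2^-1 <= S by move: S3; rewrite ler_norml => /andP[? _]; lra.
have lnE : ln (normc (1 + k)) = ln (1 + S) / 2.
  by rewrite -SE lnXn // mulr2n; lra.
have up : ln (1 + S) <= S by apply: le_ln1Dx; lra.
have lo : S - 2 * S ^+ 2 <= ln (1 + S).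
  have p : 0 < 1 + S by lra.
  have q : -1 < (1 + S)^-1 - 1 by rewrite ltrBrDl addrN invr_gt0.
  have := le_ln1Dx q; rewrite addrC subrK lnV ?posrE // => h.
  have : (1 + S)^-1 - 1 <= - S + 2 * S ^+ 2.
    rewrite lerBlDr -[leLHS]mul1r ler_pdivrMr //.
    have : 0 <= S ^+ 2 * (1 + 2 * S) by rewrite mulr_ge0 ?sqr_ge0 //; lra.
    lra.
  lra.
have S2 : S ^+ 2 <= 9 * e ^+ 2.
  rewrite -(real_normK (num_real S)).
  have -> : 9 * e ^+ 2 = (3 * e) ^+ 2 by ring.
  by rewrite ler_pXn2r ?nnegrE ?mulr_ge0.
by rewrite lnE ler_norml; apply/andP; split; move: up lo; rewrite /S; rewrite /S in S2; lra.
Qed.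

End LogKernel.

Section ParametricIntegral.
Context d1 d2 (X : measurableType d1) (Y : measurableType d2) (R : realType).
Variable m : {sigma_finite_measure set Y -> \bar R}.

(** Tonelli's theorem applies to the positive and to the negative part of [f]. *)
Lemma measurable_parametric_integral (f : X * Y -> \bar R) :
  measurable_fun setT f -> measurable_fun setT (fun x => \int[m]_y f (x, y))%E.
Proof.
move=> mf; under eq_fun do rewrite integralE; apply: emeasurable_funB.
- rewrite (_ : (fun x => _) = fubini_F m (f^\+)%E).
    by apply: measurable_fun_fubini_tonelli_F => //; exact: measurable_funepos.
  by apply/funext => x; rewrite /fubini_F (funepos_comp f (pair x)).
- rewrite (_ : (fun x => _) = fubini_F m (f^\-)%E).
    by apply: measurable_fun_fubini_tonelli_F => //; exact: measurable_funeneg.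
  by apply/funext => x; rewrite /fubini_F (funeneg_comp f (pair x)).
Qed.

End ParametricIntegral.

Section Pushforward.
Context d1 d2 (X : measurableType d1) (Y : measurableType d2) (R : realType).
Variables (phi : X -> Y) (mphi : measurable_fun setT phi).
Variables (mu : {measure set X -> \bar R}).

Lemma integral_pushforward_measurable (f : Y -> \bar R) : measurable_fun setT f ->
  (\int[pushforward mu phi]_y f y = \int[mu]_x f (phi x))%E.
Proof.
move=> mf; rewrite [LHS]integralE [RHS]integralE.
have posE := funepos_comp f phi; have negE := funeneg_comp f phi.
congr (_ - _)%E.
  rewrite (@ge0_integral_pushforward _ _ _ _ _ _ mphi mu setT (f^\+)%E) //.
    by rewrite preimage_setT; apply: eq_integral => x _; rewrite -posE.
  exact: measurable_funepos.
rewrite (@ge0_integral_pushforward _ _ _ _ _ _ mphi mu setT (f^\-)%E) //.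
  by rewrite preimage_setT; apply: eq_integral => x _; rewrite -negE.
exact: measurable_funeneg.
Qed.

End Pushforward.

(** * Integrability of the logarithmic kernel *)

Section Energy.
Variable R : realType.
Local Notation C := R[i].
Variables (m : probability C R) (r0 K : R).
Hypothesis r0_gt0 : 0 < r0.
Hypothesis m_out : m [set z | r0 < normc z] = 0%E.
Hypothesis K_ge0 : 0 <= K.
Hypothesis near_diag : forall r, 0 < r ->
  ((m \x m) (near_diagonal r) <= (Num.sqrt (K * r))%:E)%E.
Local Notation M := (m \x m)%E.

Definition generic_pair (q : C * C) : Prop :=
  [/\ normc q.1 <= r0, normc q.2 <= r0 & q.1 != q.2].

Let measurable_out : measurable [set z : C | r0 < normc z].
Proof.
rewrite (_ : [set z | _] = ~` [set z | normc (z - 0) <= r0]).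
  by apply: measurableC; apply: closed_measurable_C; exact: closed_disc.
by apply/seteqP; split=> z /=; rewrite subr0 ltNge => /negP.
Qed.

Let measurable_diagonal : measurable [set q : C * C | q.1 = q.2].
Proof.
rewrite (_ : [set q | _] = near_diagonal 0); first exact: measurable_near_diagonal.
apply/seteqP; split=> q; rewrite /near_diagonal /=.
  by move=> ->; rewrite subrr normc0.
move=> h; apply/eqP; rewrite -subr_eq0 -normc_eq0 eq_le h /=; exact: normc_ge0.
Qed.

Lemma diagonal_null : M [set q | q.1 = q.2] = 0%E.
Proof.
apply/eqP; rewrite eq_le measure_ge0 andbT; apply/lee_addgt0Pr => e e0; rewrite add0e.
pose r := e ^+ 2 / (K + 1).
have K1 : 0 < K + 1 by rewrite ltr_wpDl.
have rp : 0 < r by rewrite divr_gt0 ?exprn_gt0.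
apply: (@le_trans _ _ (M (near_diagonal r))).
  apply: le_measure; rewrite ?inE //; first exact: measurable_near_diagonal.
  by move=> q /= e1; rewrite /near_diagonal /= e1 subrr normc0 ltW.
apply: le_trans (near_diag rp) _; rewrite lee_fin.
rewrite -[leRHS]ger0_norm ?(ltW e0) // -sqrtr_sqr ler_wsqrtr //.
rewrite /r mulrCA ler_piMr ?sqr_ge0 // ler_pdivrMr // mul1r lerDl.
exact: ler01.
Qed.

Lemma generic_ae : {ae M, forall q, generic_pair q}.
Proof.
have h1 : {ae M, forall q : C * C, normc q.1 <= r0}.
  exists ([set z : C | r0 < normc z] `*` setT); split.
  - exact: measurableX.
  - rewrite product_measure1E //.
    by apply: etrans (mul0e _); congr (_ * _)%E; exact: m_out.
  - by move=> q /= /negP; rewrite -ltNge.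
have h2 : {ae M, forall q : C * C, normc q.2 <= r0}.
  exists (setT `*` [set z : C | r0 < normc z]); split.
  - exact: measurableX.
  - rewrite product_measure1E //.
    by apply: etrans (mule0 _); congr (_ * _)%E; exact: m_out.
  - by move=> q /= /negP; rewrite -ltNge.
have h3 : {ae M, forall q : C * C, q.1 != q.2}.
  exists [set q | q.1 = q.2]; split; last by move=> q /= /negP; rewrite negbK => /eqP.
    exact: measurable_diagonal.
  exact: diagonal_null.
apply: filterS3 h1 h2 h3 => q ? ? ?; exact: And3.
Qed.

Let ln4 : R := ln 4.

Let ln4_ge0 : 0 <= ln4. Proof. by rewrite ln_ge0 // ler1n. Qed.

Let quarter k : R := (4 ^+ k)^-1.

Let lk (q : C * C) := log_kernel q.1 q.2.

Let mlk : measurable_fun setT lk.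
Proof. exact: measurable_log_kernel measurable_fst measurable_snd. Qed.

Let lk_le q : generic_pair q -> (`|lk q| <= (2 * r0)%:E +
  \sum_(k <oo) (ln4 * \1_(near_diagonal (quarter k)) q)%:E)%E.
Proof.
move=> [q1 q2 q12]; rewrite /lk log_kernel_fin //=.
set s := normc (q.1 - q.2).
have s0 : 0 < s by rewrite normc_gt0 subr_eq0.
have s2 : s <= 2 * r0 by apply: le_trans (le_normcB _ _) _; lra.
have [N hN] := small_power s0.
have t0 k : (0 <= (ln4 * \1_(near_diagonal (quarter k)) q)%:E)%E.
  by rewrite lee_fin mulr_ge0 // indicE ler0n.
apply: (@le_trans _ _ ((2 * r0)%:E +
    \sum_(0 <= k < N) (ln4 * \1_(near_diagonal (quarter k)) q)%:E)%E); last first.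
  by rewrite leeD2l // nneseries_lim_ge.
rewrite sumEFin -EFinD lee_fin big_mkord.
have hl := ln_inv_le s0 hN.
have S0 : 0 <= \sum_(i < N) ln4 * \1_(near_diagonal (quarter i)) q.
  by apply: sumr_ge0 => i _; rewrite mulr_ge0 // indicE ler0n.
have E : ln4 * \sum_(k < N) (s <= quarter k)%R%:R =
    \sum_(i < N) ln4 * \1_(near_diagonal (quarter i)) q.
  rewrite mulr_sumr; apply: eq_bigr => k _; rewrite indicE; congr (_ * _).
  have -> // : (q \in near_diagonal (quarter k)) = (s <= quarter k)%R.
  by apply/idP/idP => [|h]; rewrite inE.
rewrite E in hl; rewrite ler_norml; apply/andP; split.
  have := ln_sublinear s0; lra.
lra.
Qed.

(** The pairs at distance at most [4 ^- k] have a mass of order [2 ^- k], which is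
summable. *)
Lemma log_kernel_integrable : M.-integrable setT lk.
Proof.
apply/integrableP; split; first exact: mlk.
pose u k (q : C * C) : \bar R := (ln4 * \1_(near_diagonal (quarter k)) q)%:E.
have u0 k q : (0 <= u k q)%E by rewrite lee_fin mulr_ge0 // indicE ler0n.
have mu k : measurable_fun setT (u k).
  apply/measurable_EFinP; apply: measurable_funM => //.
  by apply: measurable_indic; exact: measurable_near_diagonal.
have ms : measurable_fun setT (fun q => \sum_(k <oo) u k q)%E.
  by apply: ge0_emeasurable_sum => // k q _ _; exact: u0.
have s0 q : (0 <= \sum_(k <oo) u k q)%E by apply: nneseries_ge0 => k _ _; exact: u0.
have r20 : 0 <= 2 * r0 by rewrite mulr_ge0 // ltW.
apply: (@le_lt_trans _ _ (\int[M]_q ((2 * r0)%:E + \sum_(k <oo) u k q))%E).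
  apply: ae_ge0_le_integral => //.
  - by apply: measurableT_comp.
  - by move=> q _; rewrite adde_ge0 // lee_fin.
  - exact: emeasurable_funD.
  - by apply: filterS generic_ae => q gq _; exact: lk_le.
rewrite ge0_integralD //.
rewrite integral_cst //= probability_setT mule1.
rewrite integral_nneseries //.
apply: (@le_lt_trans _ _ ((2 * r0)%:E + (2 * (ln4 * Num.sqrt K))%:E)%E); last first.
  by rewrite -EFinD ltry.
rewrite leeD2l //.
apply: le_trans (@epsilon_trick0 R (2 * (ln4 * Num.sqrt K)) xpredT _); last first.
  by rewrite !mulr_ge0 ?sqrtr_ge0.
apply: lee_nneseries => [k _ _|k _]; first by apply: integral_ge0.
have -> : (\int[M]_q u k q = (ln4)%:E * M (near_diagonal (quarter k)))%E.
  rewrite -[X in M X]setIT -integral_indic //; last exact: measurable_near_diagonal.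
  rewrite -ge0_integralZl_EFin //; last first.
    by apply/measurable_EFinP; apply: measurable_indic; exact: measurable_near_diagonal.
have p4 : 0 < quarter k by rewrite invr_gt0 exprn_gt0.
apply: le_trans (lee_wpmul2l _ (near_diag p4)) _; first by rewrite lee_fin.
rewrite -EFinM lee_fin.
have -> : quarter k = ((2 ^+ k)^-1) ^+ 2.
  by rewrite /quarter exprVn -exprM mulnC exprM; congr ((_ ^+ _)^-1); ring.
rewrite sqrtrM // sqrtr_sqr ger0_norm ?invr_ge0 ?exprn_ge0 //.
rewrite natrX exprS.
have -> : 2 * (ln4 * Num.sqrt K) / (2 * 2 ^+ k) = ln4 * (Num.sqrt K * (2 ^+ k)^-1).
  by field; rewrite expf_neq0.
by [].
Qed.

End Energy.

Section EnergyOfNonnegativeCharges.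
Variable R : realType.
Local Notation C := R[i].

Lemma energy_nonneg (nu : {charge set C -> \bar R}) (P : {measure set C -> \bar R}) :
  (forall S, measurable S -> nu S = P S) ->
  energy nu = (\int[P]_x \int[P]_y log_kernel x y)%E.
Proof.
move=> nuP; have nu0 S : measurable S -> (0 <= nu S)%E.
  by move=> mS; rewrite nuP.
rewrite /energy (charge_integral_nonneg nu0 _ nuP); apply: eq_integral => x _.
by rewrite (charge_integral_nonneg nu0 _ nuP).
Qed.

End EnergyOfNonnegativeCharges.

(** * The first variation of the energy of the limit *)

Section Limit.
Variables (R : realType) (p : nat) (a : 'I_p.+1 -> R[i]) (B : {poly R[i]}).
Hypothesis ha : injective a.
Local Notation C := R[i].
Variables (zs : nat -> seq C) (m : probability C R) (r0 : R).
Hypothesis r0_gt0 : 0 < r0.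
Hypothesis zs_stationary : forall k, stationary a B (zs k).
Hypothesis zs_gt0 : forall k, (0 < size (zs k))%N.
Hypothesis zs_disc : forall k z, z \in zs k -> normc z <= r0.
Hypothesis zs_size : (size (zs k))%:R^-1 @[k --> \oo] --> (0 : R).
Hypothesis m_out : m [set z | r0 < normc z] = 0%E.
Hypothesis zs_lim : forall f : C -> R, continuous f ->
  mean (zs k) f @[k --> \oo] --> \int[m]_z f z.

(** The count of zeros in discs passes to the limit through a tent function, which
is at least [1 / 2] on the disc of radius [r] and vanishes outside of the disc of
radius [2 * r]. *)
Lemma disc_bound : exists2 K, 0 <= K &
  (forall k z0 r, 0 < r ->
    mean (zs k) (fun z => (normc (z - z0) <= r)%R%:R) ^+ 2 <=
    K * (r + (size (zs k))%:R^-1)) /\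
  (forall z0 r, 0 < r ->
    fine (m [set z | normc (z - z0) <= r]) ^+ 2 <= K * r).
Proof.
have [K K0 hK] := stationary_count_disc B ha (ltW r0_gt0).
have key k z0 r : 0 < r -> mean (zs k) (fun z => (normc (z - z0) <= r)%R%:R) ^+ 2
    <= K * (r + (size (zs k))%:R^-1).
  move=> rp; rewrite /mean (sum_count (fun z => normc (z - z0) <= r)) exprMn.
  have n0 : 0 < (size (zs k))%:R :> R by rewrite ltr0n.
  rewrite exprVn mulrC ler_pdivrMr ?exprn_gt0 //.
  apply: le_trans (hK _ (zs_stationary k) (@zs_disc k) z0 r rp) _.
  rewrite -mulrA ler_wpM2l // mulrDl lerD2l expr2 mulrA mulVf ?mul1r //.
  by rewrite gt_eqF.
exists (8 * K); first by rewrite mulr_ge0.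
split=> [k z0 r rp|z0 r rp].
  apply: le_trans (key k z0 r rp) _; rewrite ler_wpM2r //; last lra.
  by rewrite addr_ge0 ?invr_ge0 // ltW.
have r2 : 0 < 2 * r by rewrite mulr_gt0.
have ct : continuous (tent (2 * r) z0).
  by apply: (@lipschitz_continuous_R _ _ (2 * r)^-1) => x y; exact: lipschitz_tent.
have t01 z : 0 <= tent (2 * r) z0 z <= 1.
  rewrite tent_ge0 /tent /= ge_max ler01 andbT lerBlDr lerDl.
  by rewrite divr_ge0 ?normc_ge0 // ltW.
set I := \int[m]_z tent (2 * r) z0 z.
have I2 : I ^+ 2 <= K * (2 * r).
  have cI : mean (zs k) (tent (2 * r) z0) ^+ 2 @[k --> \oo] --> I ^+ 2.
    by rewrite expr2; under eq_fun do rewrite expr2; apply: cvgM; exact: zs_lim.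
  have cK : K * (2 * r + (size (zs k))%:R^-1) @[k --> \oo] --> K * (2 * r + 0).
    by apply: cvgMr; apply: cvgD => //; exact: cvg_cst.
  rewrite -[2 * r in leRHS]addr0.
  apply: (ler_cvg_to cI cK); apply: nearW => k.
  apply: le_trans (key k z0 _ r2).
  rewrite ler_pXn2r ?nnegrE ?mean_ge0 //; last 1 first.
  - by move=> z; rewrite tent_ge0.
  apply: le_mean => z _; have [h|h] := leP (normc (z - z0)) (2 * r).
    by case/andP: (t01 z).
  by rewrite tent_out // ltW.
have mB : measurable [set z | normc (z - z0) <= r].
  by apply: closed_measurable_C; exact: closed_disc.
have fI : fine (m [set z | normc (z - z0) <= r]) <= 2 * I.
  rewrite -lee_fin fineK ?fin_num_measure //.
  rewrite EFinM fineK; last first.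
    apply: integrable_fin_num => //.
    apply: (bounded_integrable _ (continuous_measurable_C ct)) => z.
    by have /andP[t0 t1] := t01 z; rewrite ger0_norm //; exact: t1.
  rewrite -ge0_integralZl_EFin //; last 2 first.
  - by move=> z _; rewrite lee_fin tent_ge0.
  - exact: continuous_measurable_EFin.
  rewrite -[X in m X]setIT -integral_indic //.
  apply: ge0_le_integral => //.
  - by apply/measurable_EFinP; exact: measurable_indic.
  - apply: (@continuous_measurable_EFin _ (fun z => 2 * tent (2 * r) z0 z)).
    by apply: continuous_mulR => //; exact: cst_continuous.
  move=> z _; rewrite lee_fin indicE.
  have [zr|zr] := boolP (z \in _); last by rewrite mulr_ge0 ?tent_ge0.
  move: zr; rewrite inE /= => zr.
  apply: (@le_trans _ _ (2 * (1 - normc (z - z0) / (2 * r)))).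
    suff : normc (z - z0) / (2 * r) <= 2^-1 by lra.
    by rewrite ler_pdivrMr // mulKf.
  by rewrite ler_wpM2l // le_max lexx.
have f0 : 0 <= fine (m [set z | normc (z - z0) <= r]) by exact: fine_ge0.
apply: (@le_trans _ _ ((2 * I) ^+ 2)); first by rewrite ler_pXn2r ?nnegrE // (le_trans f0).
by rewrite exprMn; lra.
Qed.

Local Notation M := (m \x m)%E.

Lemma near_diagonal_bound : exists2 K, 0 <= K & forall r, 0 < r ->
  (M (near_diagonal r) <= (Num.sqrt (K * r))%:E)%E.
Proof.
have [K K0 [_ hK]] := disc_bound; exists K => // r rp.
rewrite /product_measure1.
apply: (@le_trans _ _ (\int[m]_x (cst (Num.sqrt (K * r))%:E x))%E); last first.
  by rewrite integral_cst //= probability_setT mule1.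
apply: ge0_le_integral => //.
- by apply: measurable_fun_xsection; exact: measurable_near_diagonal.
move=> x _ /=.
have -> : xsection (near_diagonal r) x =
    [set z | normc (z - x) <= r].
  by apply/seteqP; split=> y; rewrite /xsection /= inE /near_diagonal /= normcBC.
have mB : measurable [set z : C | normc (z - x) <= r].
  by apply: closed_measurable_C; exact: closed_disc.
rewrite -[leLHS]fineK ?fin_num_measure // lee_fin.
rewrite -[leLHS]ger0_norm ?fine_ge0 // -sqrtr_sqr ler_wsqrtr //.
exact: hK.
Qed.

(** The double sum has [n ^ 2] terms but is only of order [n]. *)
Let mean_variation_cvg0 h L : 0 <= L -> lipschitzc L h ->
  (forall i, h (a i) = 0) ->
  mean (zs k) (fun x => mean (zs k) (variation_kernel h x)) @[k --> \oo] -->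
    (0 : R).
Proof.
move=> L0 hL h0.
have [K K0 hK] := stationary_variation_le B ha (ltW r0_gt0).
have up : (size (zs k))%:R^-1 * (L * K) @[k --> \oo] --> (0 : R).
  by rewrite -[0 in X in _ --> X](mul0r (L * K)); apply: cvgMl.
apply/cvgr0Pnorm_le => e e0.
have /cvgr0Pnorm_le /(_ _ e0) := up; apply: filterS => k hk.
apply: le_trans hk; rewrite [leRHS]ger0_norm ?mulr_ge0 ?invr_ge0 //.
have n0 : 0 < (size (zs k))%:R :> R by rewrite ltr0n.
rewrite /mean -mulr_sumr mulrA normrM ger0_norm ?mulr_ge0 ?invr_ge0 //.
rewrite -mulrA ler_wpM2l ?invr_ge0 // mulrC ler_pdivrMr // mulrC.
exact: hK (zs_stationary k) (@zs_disc k) _ _ L0 hL h0.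
Qed.

(** Weak convergence applies to the regularized kernels. The error made near the
diagonal is of order [sqrt d], for the zeros by [disc_bound] and for the limit by
[near_diagonal_bound], and [d] tends to [0] last. *)
Lemma first_variation h L b : 0 <= L -> lipschitzc L h ->
  (forall x, normc (h x) <= b) -> (forall i, h (a i) = 0) ->
  \int[M]_q variation_kernel h q.1 q.2 = 0.
Proof.
move=> L0 hL hb h0.
have b0 : 0 <= b by apply: le_trans (normc_ge0 _) (hb 0).
have ch : continuous h by exact: lipschitz_continuous_C hL.
have [K1 K10 [hK1 _]] := disc_bound.
have [K2 K20 hK2] := near_diagonal_bound.
set V := \int[M]_q _.
have mV : measurable_fun setT (fun q : C * C => variation_kernel h q.1 q.2).
  exact: measurable_variation_kernel ch measurable_fst measurable_snd.
have bV (q : C * C) : `|variation_kernel h q.1 q.2| <= L.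
  exact: norm_variation_kernel.
have key d : 0 < d -> `|V| <= L * Num.sqrt (K2 * d) + L * Num.sqrt (K1 * d).
  move=> d0; pose F := regular_kernel d h.
  have mF : measurable_fun setT (fun q : C * C => F q.1 q.2).
    exact: (measurable_regular_kernel ch measurable_fst measurable_snd d).
  have bF x y : `|F x y| <= L by exact: norm_regular_kernel.
  pose I := \int[M]_q F q.1 q.2.
  have IE : I = \int[m]_x (\int[m]_y F x y).
    rewrite /I /Rintegral -integral12_prod_meas1.
      congr fine; apply: eq_integral => x _; rewrite /fubini_F /= fineK //.
      apply: integrable_fin_num => //; apply: (@bounded_integrable _ _ _ _ _ L) => //.
      exact: (@measurable_regular_kernel _ _ _ h (cst x) idfun ch (measurable_cst _)
        (@measurable_id _ _ _) d).
    apply: (@bounded_integrable _ _ _ M (fun q => F q.1 q.2) L); first exact: mF.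
    by move=> q; exact: bF.
  have l0 : 0 <= L / d + 6 * b / d ^+ 2.
    by rewrite addr_ge0 ?divr_ge0 ?mulr_ge0 ?exprn_ge0 // ltW.
  have limF : mean (zs k) (fun x => mean (zs k) (F x)) @[k --> \oo] --> I.
    rewrite IE; apply: (@double_mean_cvg _ _ _ _ zs_disc zs_gt0 zs_lim F
        (L / d + 6 * b / d ^+ 2) L) => //.
      exact: lipschitz_regular_kernel.
    move=> x y y'; rewrite /F !(regular_kernelC d h x).
    exact: lipschitz_regular_kernel.
  have VI : `|I - V| <= L * Num.sqrt (K2 * d).
    rewrite /I /V -RintegralB //; last 2 first.
    - by apply: (bounded_integrable _ mF) => q; exact: bF.
    - exact: bounded_integrable bV.
    pose g (q : C * C) : R := L * \1_(near_diagonal d) q.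
    have mD : measurable (near_diagonal d) by exact: measurable_near_diagonal.
    have mi : measurable_fun setT (\1_(near_diagonal d) : C * C -> R).
      exact: measurable_indic.
    apply: le_trans (le_normr_Rintegral _ _) _ => //.
      apply: (@bounded_integrable _ _ _ M _ (L + L)).
        exact: measurable_funB.
      move=> q; apply: le_trans (ler_normB _ _) _; apply: lerD => //; exact: bF.
    have ii : M.-integrable setT (EFin \o (\1_(near_diagonal d) : C * C -> R)).
      apply: (@bounded_integrable _ _ _ M _ 1) => // q.
      by rewrite indicE; case: (_ \in _); rewrite ?normr1 ?normr0.
    apply: (@le_trans _ _ (\int[M]_q g q)).
      apply: le_Rintegral => //.
      - apply: (@bounded_integrable _ _ _ M _ (L + L)).
          by apply: measurableT_comp => //; exact: measurable_funB.
        move=> q; rewrite normr_id; apply: le_trans (ler_normB _ _) _.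
        by apply: lerD => //; exact: bF.
      - rewrite (_ : EFin \o g = (fun q => L%:E * (\1_(near_diagonal d) q)%:E)%E) //.
        exact: integrableZl.
      move=> q _; rewrite /g indicE; apply: le_trans (regular_kernel_close _ _ d0 L0 hL) _.
      rewrite ler_wpM2l // ler_nat.
      case: (boolP (normc _ <= d)) => // qd.
      by rewrite mem_set.
    rewrite RintegralZl // ler_wpM2l // /Rintegral integral_indic // setIT.
    rewrite -lee_fin fineK; first exact: hK2.
    rewrite ge0_fin_numE; last exact: measure_ge0.
    exact: le_lt_trans (hK2 _ d0) (ltry _).
  have I0 : `|I| <= L * Num.sqrt (K1 * d).
    have lim1 : `|mean (zs k) (fun x => mean (zs k) (F x))| @[k --> \oo] --> `|I|.
      exact: cvg_norm.
    have lim2 : `|mean (zs k) (fun x => mean (zs k) (variation_kernel h x))| +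
        L * Num.sqrt (K1 * (d + (size (zs k))%:R^-1)) @[k --> \oo] -->
        `|0 : R| + L * Num.sqrt (K1 * (d + 0)).
      apply: cvgD; first by apply: cvg_norm; exact: mean_variation_cvg0 hL h0.
      apply: cvgMr.
      apply: (continuous_cvg _ (@sqrt_continuous R _)).
      by apply: cvgMr; apply: cvgD => //; exact: cvg_cst.
    rewrite normr0 add0r addr0 in lim2.
    apply: (ler_cvg_to lim1 lim2); apply: nearW => k.
    rewrite -lerBlDl; apply: le_trans (lerB_dist _ _) _.
    rewrite -meanB; apply: norm_mean_le => // x _.
    rewrite -meanB.
    apply: (@le_trans _ _ (mean (zs k) (fun y => L * (normc (y - x) <= d)%R%:R))).
      rewrite ler_norml -[X in X <= _ <= _]mulN1r; apply/andP; split.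
        rewrite /mean mulrCA ler_wpM2l ?invr_ge0 // mulN1r -sumrN.
        apply: ler_sum => y _; have := regular_kernel_close x y d0 L0 hL.
        by rewrite ler_norml normcBC => /andP[].
      apply: le_mean => y _; have := regular_kernel_close x y d0 L0 hL.
      by rewrite ler_norml normcBC => /andP[].
    rewrite /mean -mulr_sumr mulrCA ler_wpM2l //.
    rewrite -[leLHS]ger0_norm; last first.
      by apply: mean_ge0 => z; rewrite ler0n.
    by rewrite -sqrtr_sqr ler_wsqrtr //; exact: hK1.
  have -> : V = I - (I - V) by ring.
  by apply: le_trans (ler_normB _ _) _; rewrite addrC lerD.
apply/eqP; rewrite -normr_le0.
pose g k : R := L * Num.sqrt (K2 * k.+1%:R^-1) + L * Num.sqrt (K1 * k.+1%:R^-1).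
have lim : g k @[k --> \oo] --> L * Num.sqrt (K2 * 0) + L * Num.sqrt (K1 * 0).
  apply: cvgD; apply: cvgMr; apply: (continuous_cvg _ (@sqrt_continuous R _));
    apply: cvgMr; exact: cvg_harmonic.
rewrite !mulr0 sqrtr0 !mulr0 addr0 in lim.
apply: (ler_cvg_to (cvg_cst `|V|) lim); apply: nearW => k.
by apply: key; rewrite invr_gt0.
Qed.

Variable mu : {charge set C -> \bar R}.
Hypothesis mum : forall S, measurable S -> mu S = m S.

Let lk (q : C * C) := log_kernel q.1 q.2.

Let lk_integrable : M.-integrable setT lk.
Proof.
have [K K0 hK] := near_diagonal_bound.
exact: log_kernel_integrable r0_gt0 m_out K0 hK.
Qed.

Let generic : {ae M, forall q, generic_pair r0 q}.
Proof.
have [K K0 hK] := near_diagonal_bound.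
exact: generic_ae m_out K0 hK.
Qed.

Let energyE : energy mu = (\int[M]_q lk q)%E.
Proof. by rewrite (energy_nonneg mum) -integral12_prod_meas1. Qed.

Lemma limit_finite_energy : finite_energy mu.
Proof.
have tvm S : measurable S -> Defs.total_variation mu S = m S.
  move=> mS; rewrite total_variation_nonneg ?mum // => U mU.
  by rewrite mum.
rewrite /finite_energy.
rewrite (eq_measure_integral m); last by move=> S mS _; exact: tvm.
under eq_integral => x _.
  rewrite (eq_measure_integral m); last by move=> S mS _; exact: tvm.
  over.
by have /integrable12ltyP := lk_integrable; apply; case/integrableP: lk_integrable.
Qed.

Lemma limit_support_compact : compact (charge_support mu).
Proof.
have oU : open [set z : C | r0 < normc z].
  rewrite (_ : [set z | _] = ~` [set z | normc (z - 0) <= r0]).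
    by apply: closed_openC; exact: closed_disc.
  by apply/seteqP; split=> z /=; rewrite subr0 ltNge => /negP.
apply: (@compact_bounded_closed _ _ r0).
  rewrite -openC openE => z /= /existsNP[U /not_implyP[oU' /not_implyP[Uz hU]]].
  apply: (@filterS _ (nbhs z) _ U); last exact: open_nbhs_nbhs.
  by move=> w Uw /= hw; apply: hU; exact: (hw U oU' Uw).
move=> z hz; rewrite leNgt; apply/negP => rz.
have := hz _ oU rz; rewrite total_variation_nonneg.
- by rewrite mum ?m_out ?ltxx //; exact: open_measurable_C.
- by move=> S mS; rewrite mum.
- exact: open_measurable_C.
Qed.

Section Field.
Hypothesis a_disc : forall i, normc (a i) <= r0.
Variables (h : C -> C) (sh : smooth h).
Hypothesis h_a : forall i, h (a i) = 0.

Let retraction z : C := r0%:C * huber r0 z.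

Let retraction_in z : normc z <= r0 -> retraction z = z.
Proof.
move=> zr; rewrite /retraction /huber max_r // mulrA -rmorphM /= divff ?mul1r //.
by rewrite gt_eqF.
Qed.

Let retraction_disc z : normc (retraction z) <= r0.
Proof.
rewrite normc_rM gtr0_norm // -[leRHS]mulr1 ler_wpM2l ?(ltW r0_gt0) //.
exact: normc_huber.
Qed.

Let lipschitz_retraction : lipschitzc 2 retraction.
Proof.
move=> x y; rewrite -mulrBr normc_rM gtr0_norm //.
have := lipschitz_huber r0_gt0 x y; rewrite -(ler_pM2l r0_gt0).
by move/le_trans; apply; rewrite mulrA mulrCA divff ?mulr1 // gt_eqF.
Qed.

(** On almost all pairs the kernel of the varied energy differs from the
logarithmic kernel by [ln (normc (1 + k))], where [k] is the increment ratio of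
[t h]. Its real part has integral zero by [first_variation], applied for each
complex [t] to the field [t h]. Composition with the retraction makes the field
globally Lipschitz and bounded, without changing it on the disc. *)
Lemma energy_variation_bound : exists d K : R, [/\ 0 < d, 0 <= K &
  forall t : C, normc t < d ->
  `|fine (energy (local_variation mu sh t)) - fine (energy mu)| <=
  K * normc t ^+ 2].
Proof.
have [L L0 hL] := smooth_lipschitz_disc r0 sh.
pose h' := h \o retraction.
have h'E z : normc z <= r0 -> h' z = h z by move=> zr; rewrite /h' /= retraction_in.
have h'L : lipschitzc (L * 2) h'.
  move=> x y; apply: le_trans (hL _ _ (retraction_disc x) (retraction_disc y)) _.
  by rewrite -mulrA ler_wpM2l // lipschitz_retraction.
have h'b z : normc (h' z) <= normc (h 0) + L * r0.
  have := hL (retraction z) 0 (retraction_disc z).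
  rewrite normc0 subr0 => /(_ (ltW r0_gt0)) h1.
  have h2 : L * normc (retraction z) <= L * r0 by rewrite ler_wpM2l.
  have := le_normcD (h (retraction z) - h 0) (h 0); rewrite subrK /h' /=; lra.
have h'a i : h' (a i) = 0 by rewrite h'E // h_a.
pose L2 := L * 2; have L20 : 0 <= L2 by rewrite mulr_ge0.
pose d := 8^-1 / (L2 + 1).
have L21 : 0 < L2 + 1 by rewrite ltr_wpDl.
exists d, (10 * L2 ^+ 2); split.
- by rewrite divr_gt0.
- by rewrite mulr_ge0 ?sqr_ge0.
move=> t td; pose e := normc t * L2.
have e0 : 0 <= e by rewrite mulr_ge0 ?normc_ge0.
have e8 : e <= 8^-1.
  have : normc t * (L2 + 1) < 8^-1 by rewrite -ltr_pdivlMr.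
  have := normc_ge0 t; rewrite /e; lra.
pose g z : C := t * h' z.
have gL : lipschitzc e g.
  by move=> x y; rewrite /g -mulrBr normcM /e -mulrA ler_wpM2l ?normc_ge0.
have gb z : normc (g z) <= normc t * (normc (h 0) + L * r0).
  by rewrite normcM ler_wpM2l ?normc_ge0.
have ga i : g (a i) = 0 by rewrite /g h'a mulr0.
have V0 := first_variation e0 gL gb ga.
have cg : continuous g by exact: lipschitz_continuous_C gL.
pose psi z : C := z + g z.
have mpsi : measurable_fun setT psi.
  apply: continuous_measurable_CC; apply: (@lipschitz_continuous_C _ _ (1 + e)) => x y.
  rewrite /psi mulrDl mul1r opprD addrACA; apply: le_trans (le_normcD _ _) _.
  by rewrite lerD2l gL.
(* On the diagonal both logarithms are ln 0 = 0. *)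
pose W (q : C * C) : R := ln (normc (psi q.1 - psi q.2)) - ln (normc (q.1 - q.2)).
have mW : measurable_fun setT W.
  apply: measurable_funB; apply: (measurableT_comp (@measurable_ln R)).
    by apply: measurable_normcB; apply: measurableT_comp => //.
  exact: measurable_normcB2.
pose k (q : C * C) := (g q.1 - g q.2) / (q.1 - q.2).
have ke q : normc (k q) <= e by exact: variation_kernel_le.
have psiE q : q.1 != q.2 -> psi q.1 - psi q.2 = (q.1 - q.2) * (1 + k q).
  move=> q12; rewrite mulrDr mulr1 /k mulrC divfK ?subr_eq0 //.
  by rewrite /psi; ring.
have k1 q : 0 < normc (1 + k q).
  have := le_normcD (1 + k q) (- k q); rewrite addrK normc1 normcN.
  have := ke q; lra.
have WE q : W q = ln (normc (1 + k q)).
  have [q12|q12] := eqVneq q.1 q.2.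
    by rewrite /W /k q12 !subrr mul0r addr0 normc1 ln1.
  have n12 : 0 < normc (q.1 - q.2) by rewrite normc_gt0 subr_eq0.
  by rewrite /W psiE // normcM lnM ?posrE // addrAC subrr add0r.
have Wv q : `|W q - variation_kernel g q.1 q.2| <= 10 * e ^+ 2.
  by rewrite WE; exact: ln_norm_expansion.
have vb (q : C * C) : `|variation_kernel g q.1 q.2| <= e by exact: norm_variation_kernel.
have Wb q : `|W q| <= 10 * e ^+ 2 + e.
  have := ler_normD (W q - variation_kernel g q.1 q.2) (variation_kernel g q.1 q.2).
  rewrite subrK; have := Wv q; have := vb q; lra.
have iW : M.-integrable setT (EFin \o W) by exact: bounded_integrable Wb.
pose phi z : C := z + t * h z.
have mphi : measurable_fun setT phi by exact: measurable_variation.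
pose lkt (q : C * C) := log_kernel (phi q.1) (phi q.2).
have mlkt : measurable_fun setT lkt.
  by apply: measurable_log_kernel; apply: measurableT_comp => //.
have lktE : ae_eq M setT lkt (fun q => lk q - (W q)%:E)%E.
  apply: filterS generic => q [q1 q2 q12] _.
  have e1 : phi q.1 - phi q.2 = psi q.1 - psi q.2 by rewrite /phi /psi /g !h'E.
  have p12 : phi q.1 != phi q.2.
    rewrite -subr_eq0 e1 psiE // mulf_neq0 ?subr_eq0 // -normc_eq0 gt_eqF //.
  rewrite /lkt /lk !log_kernel_fin // -EFinB; congr (_%:E).
  by rewrite e1 /W; ring.
have ilk' : M.-integrable setT (fun q => lk q - (W q)%:E)%E.
  exact: integrableB.
have ilkt : M.-integrable setT lkt.
  apply/integrableP; split => //.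
  rewrite (ae_eq_integral (fun q => `|lk q - (W q)%:E|%E)) //.
  - by case/integrableP: ilk'.
  - exact: measurableT_comp.
  - by apply: measurableT_comp => //; case/integrableP: ilk'.
  - by apply: filterS lktE => q h1 h2; rewrite h1.
have Et : energy (local_variation mu sh t) = (\int[M]_q lkt q)%E.
  pose P : {measure set C -> \bar R} :=
    measure_function_pushforward__canonical__measure_function_Measure m mphi.
  have lvP S : measurable S -> local_variation mu sh t S = P S.
    move=> mS; rewrite /local_variation /image_charge /P /= /pushforward mum //.
    by rewrite -[X in measurable X]setTI; exact: (mphi measurableT _ mS).
  rewrite (energy_nonneg lvP).
  have inner x : (\int[P]_y log_kernel x y = \int[m]_y log_kernel x (phi y))%E.
    apply: (integral_pushforward_measurable mphi).
    by apply: measurable_log_kernel => //; exact: measurable_cst.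
  under eq_integral do rewrite inner.
  rewrite (integral_pushforward_measurable mphi m).
    by rewrite -integral12_prod_meas1.
  apply: (@measurable_parametric_integral _ _ C C R m
    (fun q => log_kernel q.1 (phi q.2))).
  by apply: measurable_log_kernel => //; apply: measurableT_comp.
rewrite Et energyE.
rewrite (ae_eq_integral (fun q => lk q - (W q)%:E)%E) //; last first.
  by case/integrableP: ilk'.
rewrite integralB // fineB; last 2 first.
- exact: integrable_fin_num.
- exact: integrable_fin_num iW.
rewrite addrAC subrr add0r normrN.
have -> : fine (\int[M]_q (W q)%:E) = \int[M]_q W q - \int[M]_q variation_kernel g q.1 q.2.
  by rewrite V0 subr0.
have -> : 10 * L2 ^+ 2 * normc t ^+ 2 = 10 * e ^+ 2 by rewrite /e; ring.
apply: (@norm_RintegralB_le _ _ _ M _ _ (10 * e ^+ 2 + e) e) => //.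
exact: measurable_variation_kernel cg measurable_fst measurable_snd.
Qed.

End Field.
End Limit.

(** * Zero counting measures of Heine-Stieltjes polynomials *)

Section ZeroCounting.
Variable R : realType.
Local Notation C := R[i].

Lemma integral_normalized_zero_counting n (P : {poly C}) (f : C -> R) :
  continuous f -> (forall z, 0 <= f z) -> size (zeros P) = n ->
  (\int[normalized_zero_counting n P]_z (f z)%:E)%E = (mean (zeros P) f)%:E.
Proof.
move=> cf f0 sz.
have mf : measurable_fun setT (fun z => (f z)%:E) by exact: continuous_measurable_EFin.
have f0' (z : C) : setT z -> (0 <= (f z)%:E)%E by rewrite lee_fin.
rewrite /normalized_zero_counting ge0_integral_mscale //.
rewrite /zero_counting ge0_integral_measure_sum //.
under eq_bigr do rewrite integral_dirac // diracT mul1e.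
rewrite sumEFin -EFinM /= /mean sz; congr ((_ * _)%:E).
by rewrite [RHS](big_nth 0) big_mkord sz.
Qed.

Lemma cvg_dnbhs0_quadratic (f : C -> R) (d K : R) : 0 < d -> 0 <= K ->
  (forall t : C, normc t < d -> `|f t| <= K * normc t ^+ 2) ->
  (fun t : C => (f t)%:C / t) @ 0^' --> (0 : C).
Proof.
move=> d0 K0 hf S /nbhs_normcP[e e0 he].
have K1 : 0 < K + 1 by rewrite ltr_wpDl.
suff : nbhs (0 : C) [set t | t != 0 -> S ((f t)%:C / t)] by [].
apply/nbhs_normcP; exists (Num.min d (e / (K + 1))).
  by rewrite lt_min d0 divr_gt0.
move=> t; rewrite sub0r normcN lt_min => /andP[td te] t0; apply: he.
rewrite sub0r normcN normc_rM normcV.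
have nt : 0 < normc t by rewrite normc_gt0.
rewrite ltr_pdivrMr //; apply: le_lt_trans (hf t td) _.
rewrite expr2 mulrA ltr_pM2r //; move: te; rewrite ltr_pdivlMr //.
by apply: le_lt_trans; rewrite mulrC ler_wpM2l ?normc_ge0 // lerDl.
Qed.

End ZeroCounting.

Theorem corollary7p2 (R : realType) (p : nat) (hp : (0 < p)%N)
    (a : 'I_p.+1 -> R[i]) (ha : injective a)
    (alpha : R[i]) (B : {poly R[i]}) (hB : (size B <= p.+1)%N)
    (hBp : B`_p = alpha)
    (Q : nat -> {poly R[i]}) (N : nat)
    (hQ : forall n, (N <= n)%N ->
      heine_stieltjes p n alpha (\prod_(i < p.+1) ('X - (a i)%:P)) B (Q n))
    (mu : {charge set R[i] -> \bar R})
    (hmu : weak_star_limit_point (fun n => normalized_zero_counting n (Q n)) mu) :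
  mu [set: R[i]] = 1%E /\ continuous_critical (range a) mu.
Proof.
have [s [s_incr lim]] := hmu.
have s_ge k : (k <= s k)%N.
  by elim: k => // k IH; exact: leq_ltn_trans IH (s_incr _ _ (ltnSn k)).
have [r [N1 [r_ge0 zeros_bounded]]] := stationary_bounded a hB.
pose r0 : R := r + \sum_(i < p.+1) normc (a i) + 1.
have sa_ge0 : 0 <= \sum_(i < p.+1) normc (a i).
  by apply: sumr_ge0 => i _; exact: normc_ge0.
have r0_gt0 : 0 < r0 by rewrite /r0; lra.
have a_disc i : normc (a i) <= r0.
  have : normc (a i) <= \sum_(j < p.+1) normc (a j).
    rewrite (bigD1 i) //= lerDl; apply: sumr_ge0 => j _; exact: normc_ge0.
  by rewrite /r0; lra.
pose k0 := (N + N1).+1.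
pose n k := s (k + k0)%N.
pose zs k := zeros (Q (n k)).
have n_ge k : (k + k0 <= n k)%N by exact: s_ge.
have N_le k : (N <= n k)%N.
  by rewrite (leq_trans _ (n_ge k)) // /k0 -addnS addnCA leq_addr.
have zsP k := heine_stieltjes_stationary (hQ _ (N_le k)).
have zs_stationary k : stationary a B (zs k) by exact: (zsP k).2.
have zs_sizeE k : size (zs k) = n k by exact: (zsP k).1.
have zs_gt0 k : (0 < size (zs k))%N.
  by rewrite zs_sizeE (leq_trans _ (n_ge k)) // /k0 addnS.
have zs_disc k z : z \in zs k -> normc z <= r0.
  move=> zz; have h : normc z <= r.
    apply: zeros_bounded (zs_stationary k) _ z zz.
    by rewrite zs_sizeE (leq_trans _ (n_ge k)) // /k0 addnS addnA ltnW // ltnS leq_addl.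
  by rewrite /r0; lra.
have zs_size : (size (zs k))%:R^-1 @[k --> \oo] --> (0 : R).
  apply: (@squeeze_cvgr _ _ _ _ (cst 0) (fun k => k.+1%:R^-1)).
  - apply: nearW => k; rewrite invr_ge0 ler0n /= lef_pV2 ?posrE ?ltr0n //.
    rewrite ler_nat zs_sizeE; apply: leq_trans (n_ge k).
    by rewrite /k0 addnS ltnS leq_addr.
  - exact: cvg_cst.
  - exact: cvg_harmonic.
have lim_test f : test_function f -> (mean (zs k) f)%:E @[k --> \oo] -->
    charge_integral mu (fun z => (f z)%:E).
  move=> [cf f01 [b fb]].
  have := lim f cf (compact_support_disc fb).
  rewrite -(@cvg_shiftn k0); apply: cvg_trans; apply: near_eq_cvg; apply: nearW => k.
  have f0 z : 0 <= f z by case/andP: (f01 z).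
  exact: integral_normalized_zero_counting cf f0 (zs_sizeE k).
have [m [mum m_out zs_lim]] := weak_limit_probability zs_gt0 zs_disc lim_test.
split; first by rewrite mum // probability_setT.
split.
- exact: (limit_support_compact m_out mum).
- exact: (limit_finite_energy ha r0_gt0 zs_stationary zs_gt0 zs_disc zs_size m_out zs_lim mum).
move=> h sh h_a.
have ha0 i : h (a i) = 0 by apply: h_a; exists i.
have [d [K [d0 K0 hK]]] := energy_variation_bound ha r0_gt0 zs_stationary
  zs_gt0 zs_disc zs_size m_out zs_lim mum a_disc sh ha0.
exact: cvg_dnbhs0_quadratic d0 K0 hK.
Qed.
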